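(* Let $H$ be a two-qubit Hamiltonian, i.e. a $4\times 4$ complex Hermitian matrix. Then $H$ is 2-universal if and only if it does not satisfy any of the following conditions: (1) $H$ is $T$-similar to a local Hamiltonian; (2) $H$ shares an eigenvector with $T$, the gate that swaps two qubits; (3) $\operatorname{Tr}(H)=0$.
   Context: $T$ is the $4\times4$ swap matrix on $\mathbb{C}^2\otimes\mathbb{C}^2$, i.e. $T(x\otimes y)=y\otimes x$; in the standard basis $T=\begin{pmatrix}1&0&0&0\\0&0&1&0\\0&1&0&0\\0&0&0&1\end{pmatrix}$. A two-qubit Hamiltonian $H$ is 2-universal if for every unitary $U\in\mathrm{U}(4)$ and every $\varepsilon>0$ there exist $l\in\mathbb{N}$, matrices $H_1,\dots,H_l\in\{H,\,THT\}$ and times $t_1,\dots,t_l>0$ such that $\|U-e^{-iH_1t_1}e^{-iH_2t_2}\cdots e^{-iH_lt_l}\|_\infty<\varepsilon$, where $\|\cdot\|_\infty$ is the spectral (operator) norm. Matrices $A,B\in \mathrm{M}_4(\mathbb{C})$ are $T$-similar if there is a unitary $P\in\mathrm{U}(4)$ with $B=PAP^\dagger$ and $PT=TP$. A two-qubit Hamiltonian is local if it equals $H_1\otimes I+I\otimes H_2$ for some $2\times2$ Hermitian matrices $H_1,H_2$, where $I$ is the $2\times 2$ identity. ''Shares an eigenvector with $T$'' means that there is a nonzero vector that is an eigenvector of both $H$ and $T$. *)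

(* Defs.v *)
From HB Require Import structures.
From mathcomp Require Import all_boot all_order all_algebra perm.
From mathcomp Require Import all_classical all_reals all_analysis.
From mathcomp Require Export complex.
From mathcomp Require Import mxtens.
Set Implicit Arguments.
Unset Strict Implicit.
Unset Printing Implicit Defensive.
Import Order.TTheory GRing.Theory Num.Theory.
Import numFieldNormedType.Exports.
Local Open Scope classical_set_scope.
Local Open Scope ring_scope.
Local Open Scope sesquilinear_scope.
Local Open Scope complex_scope.


(* The limit is for the entrywise (sup-norm) topology on matrices. *)
Definition expmx (K : numFieldType) (n : nat) (A : 'M[K]_n) : 'M[K]_n :=
  lim (series (fun k : nat => (k`!%:R)^-1 *: A ^+ k) @ \oo).

Definition l2norm (R : realType) (n : nat) (v : 'cV[R[i]]_n) : R :=
  Num.sqrt (\sum_(k < n) Normc.normc (v k 0) ^+ 2).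

Definition opnorm (R : realType) (n : nat) (A : 'M[R[i]]_n) : R :=
  sup [set l2norm (A *m v) | v in [set v : 'cV[R[i]]_n | l2norm v = 1]].

(* C^4 is identified with C^2 (x) C^2 by [mxtens_index]: the basis vector
   e_i (x) e_j has index 2 i + j, so swapping the two qubits exchanges the
   indices 1 and 2; see [swapgateE]. *)
Definition swapgate (R : realType) : 'M[R[i]]_4 := tperm_mx (inord 1) (inord 2).

Lemma swapgateE (R : realType) (x y : 'cV[R[i]]_2) :
  swapgate R *m (x *t y) = y *t x.
Proof.
apply/matrixP => i j; rewrite /swapgate -row_permE !mxE !ord1.
rewrite [RHS]mulrC; congr (x _ _ * y _ _); try exact: val_inj.
all: apply: val_inj; rewrite permE /=.
all: by case: i => [[|[|[|[|i]]]] //= Hi]; rewrite -!val_eqE /= !inordK.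
Qed.

Definition two_universal (R : realType) (H : 'M[R[i]]_4) : Prop :=
  forall (U : 'M[R[i]]_4) (eps : R), U \is unitarymx -> 0 < eps ->
  exists (l : nat) (Hs : 'I_l -> 'M[R[i]]_4) (ts : 'I_l -> R),
    [/\ forall k, Hs k = H \/ Hs k = swapgate R *m H *m swapgate R,
        forall k, 0 < ts k &
        opnorm (U - \prod_(k < l) expmx ((- 'i%C * (ts k)%:C) *: Hs k)) < eps].

Definition T_similar (R : realType) (A B : 'M[R[i]]_4) : Prop :=
  exists P : 'M[R[i]]_4,
    [/\ P \is unitarymx, B = P *m A *m P^t* &
        P *m swapgate R = swapgate R *m P].

Definition local_hamiltonian (R : realType) (H : 'M[R[i]]_4) : Prop :=
  exists H1 H2 : 'M[R[i]]_2,
    [/\ H1 \is hermsymmx, H2 \is hermsymmx &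
        H = H1 *t (1%:M : 'M[R[i]]_2) + (1%:M : 'M[R[i]]_2) *t H2].

Definition is_eigenvector (F : fieldType) (n : nat) (A : 'M[F]_n)
    (v : 'cV[F]_n) : Prop :=
  v != 0 /\ exists a : F, A *m v = a *: v.

Definition share_eigenvector (F : fieldType) (n : nat) (A B : 'M[F]_n) : Prop :=
  exists v : 'cV[F]_n, is_eigenvector A v /\ is_eigenvector B v.

(* Main.v *)
(** Let [G] be the closure of the set of products of evolutions [exp(-itH)] and
    [exp(-itTHT)] with [t > 0].  By recurrence in a compact group, [G] is closed
    under inverses, so the Hermitian [K] with [exp(-itK)] in [G] for all real
    [t] form a real Lie algebra, and [H] is universal as soon as it contains all
    Hermitian matrices.

    Splitting C^4 into the triplet space and the singlet, and diagonalizing the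
    triplet block, [H] is T-similar to [[diag a, b], [b^*, c]], and the Lie
    algebra contains [diag(a, c)] and [M b], where [M v := [[0, v], [v^*, 0]]].
    If [H] and [T] share no eigenvector, the [a_k] are distinct and the [b_k]
    are nonzero.  The real space [V] of all [v] with [M v] in the Lie algebra is
    stable under [v |-> i d v], [d := a - c], and under a triple product; if it
    contains [u] and [iu] for some nonzero [u], it is complex, hence everything
    by a Vandermonde argument.  Such a [u] exists unless [d] is a permutation of
    [(l, 0, -l)] with [|b_k|] equal at [l] and [-l], which is exactly the normal
    form of a local Hamiltonian.  Finally, [V = C^3] yields all traceless
    Hermitian matrices, and the trace of [H] the remaining direction.

    Conversely, each of the three conditions forces a polynomial identity on the
    entries of all products, which passes to limits and fails for some unitary
    matrix. *)

From HB Require Import structures.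
Require Import Defs.
From mathcomp Require Import all_boot all_order all_algebra perm.
From mathcomp Require Import all_classical all_reals all_analysis.
From mathcomp Require Import mxtens ring lra.
Set Implicit Arguments.
Unset Strict Implicit.
Unset Printing Implicit Defensive.
Import Order.TTheory GRing.Theory Num.Theory.
Import numFieldNormedType.Exports.
Local Open Scope classical_set_scope.
Local Open Scope ring_scope.
Local Open Scope sesquilinear_scope.

(** * Lie algebras containing an arrowhead matrix *)

Lemma hermitian_trC (F : numClosedFieldType) (n : nat) (K : 'M[F]_n) :
  reflect (K^t* = K) (K \is hermsymmx).
Proof.
apply: (iffP (is_hermitianmxP _ _ _)); rewrite expr0 scale1r; first by move <-.
by move->.
Qed.

Section Algebra.
Context {F : numClosedFieldType} {m : nat}.
Implicit Types (u v w : 'cV[F]_m) (g : 'M[F]_(m + 1) -> Prop).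

(** The factor ['i] makes the bracket of two Hermitian matrices Hermitian; only real scalars
    preserve hermiticity. *)
Definition real_lie g :=
  [/\ forall A B, g A -> g B -> g (A + B),
      forall a A, a \is Num.real -> g A -> g (a *: A) &
      forall A B, g A -> g B -> g ('i *: (A *m B - B *m A))].

(** The conjugate in the lower corner makes this map only real-linear, so closure under
    [v |-> 'i *: v] is a separate question. *)
Definition arrow v : 'M[F]_(m + 1) := block_mx 0 v (v^t*) 0.

Lemma trC_add (p q : nat) (A B : 'M[F]_(p, q)) : (A + B)^t* = A^t* + B^t*.
Proof. by rewrite linearD map_mxD. Qed.

Lemma trC_opp (p q : nat) (A : 'M[F]_(p, q)) : (- A)^t* = - A^t*.
Proof. by rewrite linearN map_mxN. Qed.

Lemma trC_scale (p q : nat) a (A : 'M[F]_(p, q)) : (a *: A)^t* = a^* *: A^t*.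
Proof. by rewrite linearZ map_mxZ. Qed.

Lemma trC_mul (p q r : nat) (A : 'M[F]_(p, q)) (B : 'M[F]_(q, r)) :
  (A *m B)^t* = B^t* *m A^t*.
Proof. by rewrite trmx_mul map_mxM. Qed.

Lemma realCi (a : F) : a \is Num.real -> a^* = a.
Proof. by move/CrealP. Qed.

Lemma arrowD v w : arrow (v + w) = arrow v + arrow w.
Proof. by rewrite /arrow add_block_mx !addr0 trC_add. Qed.

Lemma arrowZ (a : F) v : a \is Num.real -> arrow (a *: v) = a *: arrow v.
Proof. by move=> /realCi ha; rewrite /arrow scale_block_mx !scaler0 trC_scale ha. Qed.

Lemma arrow_bracket u v :
  arrow u *m arrow v - arrow v *m arrow u =
  block_mx (u *m v^t* - v *m u^t*) 0 0 (u^t* *m v - v^t* *m u).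
Proof.
rewrite /arrow !mulmx_block !mulmx0 !mul0mx !addr0 !add0r.
by rewrite opp_block_mx add_block_mx !subrr.
Qed.

Lemma block_arrow_bracket (A : 'M[F]_m) (s : 'M[F]_1) v : A^t* = A -> s^t* = s ->
  'i *: (block_mx A 0 0 s *m arrow v - arrow v *m block_mx A 0 0 s) =
  arrow ('i *: (A *m v - v *m s)).
Proof.
move=> hA hs; rewrite /arrow !mulmx_block !mulmx0 !mul0mx !addr0 !add0r.
rewrite opp_block_mx add_block_mx !subrr scale_block_mx !scaler0; congr block_mx.
rewrite trC_scale conjCi trC_add trC_opp !trC_mul hA hs scaleNr -scalerN opprB.
by [].
Qed.

Section Closure.
Variable g : 'M[F]_(m + 1) -> Prop.
Hypothesis lg : real_lie g.
Local Notation V v := (g (arrow v)).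

Lemma arrowD_closed v w : V v -> V w -> V (v + w).
Proof. by rewrite arrowD; case: lg => h _ _; exact: h. Qed.

Lemma arrowZ_closed a v : a \is Num.real -> V v -> V (a *: v).
Proof. by move=> ha; rewrite arrowZ //; case: lg => _ h _; exact: h. Qed.

Lemma arrowN_closed v : V v -> V (- v).
Proof. by rewrite -scaleN1r; apply: arrowZ_closed; rewrite rpredN rpred1. Qed.

(** Block-diagonal matrices and arrows are the even and odd parts of a grading: two arrows bracket
    to an even matrix, which brackets with a third arrow to an arrow. *)
Lemma arrow_triple u v w : V u -> V v -> V w ->
  V (u *m (v^t* *m w) - v *m (u^t* *m w) - w *m (u^t* *m v - v^t* *m u)).
Proof.
case: lg => _ _ gB hu hv hw.
have := gB _ _ (gB _ _ hu hv) hw; rewrite arrow_bracket scale_block_mx !scaler0.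
rewrite block_arrow_bracket; last 2 first.
- by rewrite trC_scale conjCi trC_add trC_opp !trC_mul !trmxCK scaleNr -scalerN opprB.
- by rewrite trC_scale conjCi trC_add trC_opp !trC_mul !trmxCK scaleNr -scalerN opprB.
rewrite -scalemxAl -scalemxAr -scalerBr scalerA -expr2 sqrCi scaleN1r => /arrowN_closed.
by rewrite opprK mulmxBl !mulmxA.
Qed.

(* {u, iu, w} = -2i ((u^* w) u + |u|^2 w) for the triple product above. *)
Lemma arrow_imaginary u w : u != 0 -> V u -> V ('i *: u) -> V w -> V ('i *: w).
Proof.
move=> u0 hu hiu hw.
have [z hz] : exists z, u^t* *m w = z%:M by exists ((u^t* *m w) 0 0); exact: mx11_scalar.
set nu := (u^t* *m u) 0 0.
have hnu : u^t* *m u = nu%:M by exact: mx11_scalar.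
have nu0 : 0 < nu.
  rewrite /nu mxE lt_neqAle sumr_ge0 ?andbT; last first.
    by move=> k _; rewrite !mxE mulrC mul_conjC_ge0.
  apply: contraNneq u0 => /esym /eqP.
  rewrite psumr_eq0; last by move=> k _; rewrite !mxE mulrC mul_conjC_ge0.
  move=> /allP h; apply/eqP/colP => k; have := h k (mem_index_enum _).
  by rewrite !mxE /= mulf_eq0 conjC_eq0 orbb => /eqP.
(* Real combinations of [u] and [iu] give every complex multiple of [u]; this one cancels the
   component along [u] of the triple product. *)
have hzu : V ((2 * 'i * z) *: u).
  rewrite (_ : 2 * 'i * z = 2 * 'Re z * 'i - 2 * 'Im z); last first.
    rewrite {1}[z]Crect; have := @sqrCi F; set i := 'i => hi.
    by rewrite mulrDr [2 * i * (i * _)]mulrA -[2 * i * i]mulrA -expr2 hi; ring.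
  rewrite scalerBl -scalerA.
  apply: arrowD_closed; last apply: arrowN_closed; apply: arrowZ_closed => //.
  - by rewrite rpredM ?Creal_Re // rpredMn ?rpred1.
  - by rewrite rpredM ?Creal_Im // rpredMn ?rpred1.
have /arrowN_closed h1 := arrowD_closed (arrow_triple hu hiu hw) hzu.
have inu : (2 * nu)^-1 \is Num.real by rewrite ger0_real // invr_ge0 mulr_ge0 // ltW.
have := arrowZ_closed inu h1; congr (g (arrow _)).
rewrite trC_scale conjCi -!scalemxAl -!scalemxAr hz hnu mulmxBr -!scalemxAr !mul_mx_scalar.
apply/colP => k; rewrite !mxE; field.
by rewrite gt_eqF //= pnatr_eq0.
Qed.

(** * Vectors generated from [b] by the diagonal part *)

Section Krylov.
Variables (a : 'I_m -> F) (c : F) (b : 'cV[F]_m).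
Hypothesis areal : forall k, a k \is Num.real.
Hypothesis creal : c \is Num.real.
Let D := block_mx (diag_mx (\row_k a k)) 0 0 c%:M : 'M[F]_(m + 1).
Hypothesis gD : g D.
Hypothesis Vb : V b.
Let d k := a k - c.

Lemma arrow_ad v : V v -> V (\col_k ('i * d k * v k 0)).
Proof.
case: lg => _ _ gB hv; have := gB _ _ gD hv.
rewrite block_arrow_bracket.
- rewrite mul_diag_mx mul_mx_scalar; congr (g (arrow _)).
  by apply/colP => k; rewrite !mxE /d; ring.
- rewrite tr_diag_mx map_diag_mx; congr diag_mx; apply/rowP => k.
  by rewrite !mxE; exact: realCi.
- by rewrite tr_scalar_mx map_scalar_mx; congr (_%:M); exact: realCi.
Qed.

(** Two applications of [arrow_ad] multiply coordinate [k] by the real number [- d k ^+ 2], so real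
    polynomials in the squares act on [b] before [V] is known to be complex. *)
Lemma arrow_prod_sq (s : seq F) : {in s, forall r, r \is Num.real} ->
  V (\col_k ((\prod_(r <- s) (d k ^+ 2 - r ^+ 2)) * b k 0)).
Proof.
elim: s => [|r s IH] hs.
  by move: Vb; congr (g (arrow _)); apply/colP => k; rewrite !mxE big_nil mul1r.
have {}IH : V (\col_k ((\prod_(r <- s) (d k ^+ 2 - r ^+ 2)) * b k 0)).
  by apply: IH => x xs; apply: hs; rewrite inE xs orbT.
have hr : r ^+ 2 \is Num.real by rewrite rpredX // hs ?mem_head.
have := arrowN_closed (arrowD_closed (arrow_ad (arrow_ad IH)) (arrowZ_closed hr IH)).
congr (g (arrow _)).
apply/colP => k; rewrite !mxE big_cons; have := @sqrCi F; set i := 'i => hi.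
by rewrite mulrA [i * _ * (i * _)]mulrACA -expr2 hi; ring.
Qed.

(** By [arrow_imaginary], one pair [u], [iu] makes [V] complex. Then all polynomials in [d] act on
    [b], and Lagrange interpolation at the distinct values [d k] isolates each basis vector. *)
Lemma arrow_full u v : u != 0 -> V u -> V ('i *: u) -> injective a ->
  (forall k, b k 0 != 0) -> V v.
Proof.
move=> u0 hu hiu ainj b0.
have Vi w : V w -> V ('i *: w) by exact: arrow_imaginary u0 hu hiu.
have VC z w : V w -> V (z *: w).
  move=> hw; rewrite [z]Crect scalerDl [_ * 'Im z]mulrC -scalerA.
  by apply: arrowD_closed; apply: arrowZ_closed; rewrite ?Creal_Re ?Creal_Im //; exact: Vi.
have V_prod (s : seq F) : V (\col_k ((\prod_(r <- s) (d k - r)) * b k 0)).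
  elim: s => [|r s IH].
    by move: Vb; congr (g (arrow _)); apply/colP => k; rewrite !mxE big_nil mul1r.
  have := arrowD_closed (VC (- 'i) _ (arrow_ad IH)) (VC (- r) _ IH); congr (g (arrow _)).
  apply/colP => k; rewrite !mxE big_cons; have := @sqrCi F; set i := 'i => hi.
  by rewrite !mulrA mulNr -expr2 hi; ring.
have V_delta j z : V (z *: delta_mx j 0).
  pose p := (\prod_(r <- [seq d k | k <- enum 'I_m & k != j]) (d j - r)) * b j 0.
  have p0 : p != 0.
    rewrite mulf_neq0 // prodf_seq_neq0; apply/allP => r /mapP[k].
    rewrite mem_filter => /andP[kj _] -> /=; rewrite /d opprB addrA subrK subr_eq0.
    by apply: contra kj => /eqP /ainj ->.
  have := VC (z / p) _ (V_prod [seq d k | k <- enum 'I_m & k != j]).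
  congr (g (arrow _)); apply/colP => k; rewrite !mxE andbT.
  have [->|kj] := eqVneq k j; first by rewrite -/p mulfVK // mulr1.
  rewrite (_ : \prod_(_ <- _) _ = 0) ?mul0r ?mulr0 //.
  apply/eqP; rewrite prodf_seq_eq0; apply/hasP; exists (d k); last by rewrite /= subrr.
  by apply/mapP; exists k => //; rewrite mem_filter kj mem_enum.
have -> : v = \sum_j v j 0 *: delta_mx j 0.
  by rewrite {1}[v]matrix_sum_delta; apply: eq_bigr => j _; rewrite big_ord1.
have V0 : V 0 by rewrite -(scale0r u); apply: VC.
by elim/big_rec: _ => // j w _ hw; apply: arrowD_closed.
Qed.

(* The product of the [d^2 - d_k^2], [k != j], maps [b] to a multiple [u] of the
   basis vector [e_j], and [i d u = d_j (iu)] with [d_j] real and nonzero. *)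
Lemma arrow_full_isolated j v : injective a -> (forall k, b k 0 != 0) ->
  d j != 0 -> (forall k, k != j -> d j + d k != 0) -> V v.
Proof.
move=> ainj b0 dj dk.
have dreal k : d k \is Num.real by rewrite rpredB.
pose s := [seq d k | k <- enum 'I_m & k != j].
pose p := (\prod_(r <- s) (d j ^+ 2 - r ^+ 2)) * b j 0.
have p0 : p != 0.
  rewrite mulf_neq0 // prodf_seq_neq0; apply/allP => r /mapP[k].
  rewrite mem_filter => /andP[kj _] -> /=; rewrite subr_sqr mulf_neq0 ?dk //.
  rewrite /d opprB addrA subrK subr_eq0.
  by apply: contra kj => /eqP /ainj ->.
have Vu : V (p *: delta_mx j 0).
  have sreal : {in s, forall r, r \is Num.real} by move=> r /mapP[k _ ->].
  have := arrow_prod_sq sreal; congr (g (arrow _)); apply/colP => k; rewrite !mxE andbT.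
  have [->|kj] := eqVneq k j; first by rewrite -/p mulr1.
  rewrite (_ : \prod_(_ <- _) _ = 0) ?mul0r ?mulr0 //.
  apply/eqP; rewrite prodf_seq_eq0; apply/hasP; exists (d k); last by rewrite /= subrr.
  by apply/mapP; exists k => //; rewrite mem_filter kj mem_enum.
apply: (@arrow_full (p *: delta_mx j 0)) => //.
  apply/negP => /eqP/colP/(_ j); rewrite !mxE !eqxx mulr1.
  by move=> e; rewrite e eqxx in p0.
have ij : (d j)^-1 \is Num.real by rewrite rpredV.
have := arrowZ_closed ij (arrow_ad Vu); congr (g (arrow _)); apply/colP => k; rewrite !mxE andbT.
by have [->|kj] := eqVneq k j; [field | rewrite !mulr0].
Qed.

(* [d^2 b] and [i d b] are supported on [{j1, j2}]; their bracket acts on the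
   multiples of [e_j0] as [i] times a real number, which is nonzero because the
   moduli differ. *)
Lemma arrow_full_pair j0 j1 j2 v : injective a -> (forall k, b k 0 != 0) ->
  (forall k, [|| k == j0, k == j1 | k == j2]) -> j0 != j1 -> j0 != j2 -> j1 != j2 ->
  d j0 = 0 -> d j2 = - d j1 -> d j1 != 0 -> `|b j1 0| != `|b j2 0| -> V v.
Proof.
move=> ainj b0 hj n01 n02 n12 d0 d2 d1 nb.
have dreal k : d k \is Num.real by rewrite rpredB.
set l := d j1 in d2 d1.
have lr : l \is Num.real by exact: dreal.
have lc : l^* = l by exact: realCi.
have n10 : j1 != j0 by rewrite eq_sym.
have n20 : j2 != j0 by rewrite eq_sym.
have n21 : j2 != j1 by rewrite eq_sym.
have sum3 (f : 'I_m -> F) : \sum_k f k = f j0 + f j1 + f j2.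
  rewrite (bigD1 j0) //= (bigD1 j1) //= (bigD1 j2) ?n20 ?n21 //= big1 ?addr0 ?addrA //.
  by move=> k /andP[/andP[k0 k1] k2]; move: (hj k); rewrite (negbTE k0) (negbTE k1) (negbTE k2).
(* The factor [d^2 - l^2] kills the coordinates [j1] and [j2] and equals [- l^2] at [j0]. *)
pose w : 'cV[F]_m := delta_mx j0 0 *m (b j0 0)%:M.
have hw : V w.
  have lr2 : {in [:: l], forall r, r \is Num.real} by move=> r; rewrite inE => /eqP ->.
  have h := arrow_prod_sq lr2.
  have il : - (l ^+ 2)^-1 \is Num.real by rewrite rpredN rpredV rpredX.
  have := arrowZ_closed il h; congr (g (arrow _)); apply/colP => k.
  rewrite /w mul_mx_scalar !mxE andbT big_seq1.
  case/or3P: (hj k) => /eqP ->.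
  - by rewrite d0 eqxx mulr1; field.
  - by rewrite (negbTE n10) mulr0 -/l; ring.
  - by rewrite (negbTE n20) mulr0 d2; ring.
pose f : 'cV[F]_m := \col_k (d k ^+ 2 * b k 0).
have hf : V f.
  have r0 : {in [:: 0 : F], forall r, r \is Num.real}.
    by move=> r; rewrite inE => /eqP ->; exact: rpred0.
  have := arrow_prod_sq r0; congr (g (arrow _)); apply/colP => k.
  by rewrite !mxE big_seq1 expr0n subr0.
have hg := arrow_ad Vb; set gg := \col_k _ in hg.
have w0 : w != 0.
  apply/negP => /eqP/colP/(_ j0); rewrite /w mul_mx_scalar !mxE !eqxx mulr1.
  by move=> e; have := b0 j0; rewrite e eqxx.
have fw : f^t* *m w = 0.
  apply/matrixP => x y; rewrite !ord1 /w mul_mx_scalar !mxE sum3 !mxE d0 !eqxx.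
  by rewrite (negbTE n10) (negbTE n20) expr0n mul0r rmorph0 !mulr0 mul0r !addr0.
have gw : gg^t* *m w = 0.
  apply/matrixP => x y; rewrite !ord1 /w mul_mx_scalar !mxE sum3 !mxE d0 !eqxx.
  by rewrite (negbTE n10) (negbTE n20) mulr0 mul0r rmorph0 !mulr0 mul0r !addr0.
(* Each product sums [d^3 |b|^2] up to a factor [i] or [-i]; the power of [d] is odd, so the
   opposite values at [j1] and [j2] produce a difference of squared moduli. *)
have fg : f^t* *m gg - gg^t* *m f = (2 * 'i * l ^+ 3 * (`|b j1 0| ^+ 2 - `|b j2 0| ^+ 2))%:M.
  apply/matrixP => x y; rewrite !ord1 !mxE !sum3 !mxE d0 d2 -/l !normCK !rmorphM /=.
  rewrite ?rmorphXn /= ?rmorphN /= lc conjCi rmorph0.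
  set i := 'i; set z1 := _^*; set z2 := _^*; set z3 := _^*; ring.
apply: (@arrow_full w) => //.
have := arrow_triple hf hg hw; rewrite fw gw !mulmx0 subrr sub0r fg mul_mx_scalar => h.
pose q := 2 * l ^+ 3 * (`|b j1 0| ^+ 2 - `|b j2 0| ^+ 2).
have qr : - q^-1 \is Num.real.
  rewrite rpredN rpredV !rpredM ?rpredX ?rpredB ?rpredX ?normr_real //.
  by rewrite rpredMn ?rpred1.
have q0 : q != 0.
  rewrite !mulf_neq0 ?expf_neq0 ?pnatr_eq0 // subr_eq0.
  by rewrite eqrXn2.
have := arrowZ_closed qr h; congr (g (arrow _)); rewrite -scaleNr scalerA; congr (_ *: _).
rewrite (_ : 2 * 'i * _ * _ = 'i * q); last by rewrite /q; ring.
by rewrite mulrNN mulrCA mulVf ?mulr1.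
Qed.

End Krylov.

(* Bracketing [arrow x] with [arrow (ix)] gives [xx^*] on the diagonal, balanced
   by [-|x|^2] in the corner. *)
Lemma real_lie_full (A0 : 'M[F]_m) (c0 : F) (K : 'M[F]_(m + 1)) :
  (forall v, V v) -> g (block_mx A0 0 0 c0%:M) ->
  \tr A0 + c0 \is Num.real -> \tr A0 + c0 != 0 -> A0 \is hermsymmx ->
  K \is hermsymmx -> g K.
Proof.
case: lg => gD gZ gB Vall gX tr_real tr0 hA0 hK.
have g_rank1 t x : t \is Num.real -> g (t *: block_mx (x *m x^t*) 0 0 (- (x^t* *m x))).
  move=> ht; have := gB _ _ (Vall x) (Vall ('i *: x)); rewrite arrow_bracket.
  have hh : t / 2 \is Num.real by rewrite rpredM ?rpredV ?rpredMn ?rpred1.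
  move=> /(gZ _ _ hh); congr g.
  rewrite !trC_scale conjCi -!scalemxAl -!scalemxAr !scaleNr opprK.
  have := @sqrCi F; set i := 'i => hi.
  move: (x *m x^t*) (x^t* *m x) => X Y.
  rewrite !scale_block_mx !scaler0; congr block_mx.
    apply/matrixP => p q; rewrite !mxE (_ : t / 2 * _ = - (i ^+ 2) * (t * X p q)); last by field.
    by rewrite hi opprK mul1r.
  apply/matrixP => p q; rewrite !mxE (_ : t / 2 * _ = i ^+ 2 * (t * Y p q)); last by field.
  by rewrite hi mulN1r mulrN.
have g0 : g 0 by have := gZ 0 _ (rpred0 _) gX; rewrite scale0r.
(* The spectral theorem writes [A] as a real combination of rank-one projections, whose corners add
   up to minus the trace. *)
have g_traceless (A : 'M[F]_m) : A \is hermsymmx -> g (block_mx A 0 0 (- (\tr A)%:M)).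
  move=> hA; have hP := spectral_unitarymx A; set P := spectralmx A in hP.
  have /orthomx_spectralP eA := hermitian_normalmx hA; rewrite -/P (invmx_unitary hP) in eA.
  set t := spectral_diag A in eA.
  have treal k : t 0 k \is Num.real.
    by have /mxOverP := hermitian_spectral_diag_real hA; apply.
  have -> : block_mx A 0 0 (- (\tr A)%:M) =
      \sum_k (t 0 k *: block_mx ((row k P)^t* *m ((row k P)^t*)^t*) 0 0
                       (- (((row k P)^t*)^t* *m (row k P)^t*))).
    have e1 : A = \sum_k t 0 k *: ((row k P)^t* *m row k P).
      rewrite {1}eA; apply/matrixP => p q; rewrite mxE summxE; apply: eq_bigr => k _.
      by rewrite mul_mx_diag !mxE big_ord1 !mxE; ring.
    have e2 k : row k P *m (row k P)^t* = 1%:M.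
      apply/matrixP => x y; rewrite !ord1; have /matrixP/(_ k k) := unitarymxP hP.
      by rewrite !mxE eqxx => <-; apply: eq_bigr => q _; rewrite !mxE.
    have e3 : (\tr A)%:M = \sum_k t 0 k *: (1%:M : 'M[F]_1).
      rewrite {1}eA mxtrace_mulC mulmxA (unitarymxP hP) mul1mx mxtrace_diag.
      by rewrite -scaler_suml scalemx1.
    rewrite {1}e1 e3 -sumrN.
    have sum_block (X : 'I_m -> 'M[F]_m) (Y : 'I_m -> 'M[F]_1) :
        \sum_k block_mx (X k) 0 0 (Y k) = block_mx (\sum_k X k) 0 0 (\sum_k Y k).
      elim/big_rec3: _ => [|k x y z _ ->]; first by rewrite block_mx0.
      by rewrite add_block_mx !addr0.
    rewrite -sum_block; apply: eq_bigr => k _.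
    by rewrite scale_block_mx !scaler0 trmxCK e2 scalerN.
  have : forall (r : seq 'I_m), g (\sum_(k <- r)
      (t 0 k *: block_mx ((row k P)^t* *m ((row k P)^t*)^t*) 0 0
                       (- (((row k P)^t*)^t* *m (row k P)^t*)))).
    elim => [|k r IH]; first by rewrite big_nil.
    by rewrite big_cons; apply: gD => //; exact: g_rank1.
  by move=> h; exact: h.
(* Subtracting the traceless completion of [A0] from the given diagonal matrix leaves only
   [\tr A0 + c0] in the corner. *)
have g_corner (r : F) : r \is Num.real -> g (block_mx 0 0 0 r%:M).
  move=> hr; have hq : r / (\tr A0 + c0) \is Num.real by rewrite rpredM ?rpredV.
  have := gZ _ _ hq (gD _ _ gX (gZ _ _ (rpredN1 _) (g_traceless _ hA0))).
  congr g; rewrite scale_block_mx add_block_mx scale_block_mx !scaler0 !addr0 !scaler0.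
  by rewrite !scaleN1r subrr opprK scaler0 -raddfD /= scale_scalar_mx [c0 + _]addrC mulfVK.
have /hermitian_trC hKc := hK.
have hur : (ursubmx K)^t* = dlsubmx K by rewrite trmx_ursub map_dlsubmx hKc.
have hul : (ulsubmx K)^t* = ulsubmx K by rewrite trmx_ulsub map_ulsubmx hKc.
have hdr : (drsubmx K)^t* = drsubmx K by rewrite trmx_drsub map_drsubmx hKc.
have hulh : ulsubmx K \is hermsymmx by apply/hermitian_trC.
pose r := drsubmx K 0 0 + \tr (ulsubmx K).
have rr : r \is Num.real.
  rewrite rpredD // ?rpred_sum // => [|k _].
    by apply/CrealP; move/matrixP: hdr => /(_ 0 0); rewrite !mxE.
  by apply/CrealP; move/matrixP: hul => /(_ k k); rewrite !mxE.
have := gD _ _ (Vall (ursubmx K)) (gD _ _ (g_traceless _ hulh) (g_corner r rr)).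
congr g; rewrite /arrow !add_block_mx hur !addr0 !add0r -[RHS]submxK; congr block_mx.
by rewrite {1}[drsubmx K]mx11_scalar /r raddfD /= addrCA addNr addr0.
Qed.

End Closure.
End Algebra.

(** * Normal form up to T-similarity *)

Section NormalForm.
Context {F : numClosedFieldType}.

Definition mx4 (s : seq (seq F)) : 'M[F]_4 := \matrix_(i, j) (nth [::] s i)`_j.

Definition rsqrt2 : F := (sqrtC 2)^-1.

Lemma rsqrt2_sqr : rsqrt2 * rsqrt2 = 2^-1.
Proof. by rewrite /rsqrt2 -invfM -expr2 sqrtCK. Qed.

Lemma rsqrt2_real : rsqrt2^* = rsqrt2.
Proof. by apply: realCi; rewrite rpredV ger0_real // sqrtC_ge0. Qed.

Local Notation s := rsqrt2.

(** The swap gate over any closed field with conjugation, so that the normal form is pure algebra;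
    over [R[i]] it is convertible to [swapgate R]. *)
Definition swapF : 'M[F]_4 := tperm_mx (inord 1) (inord 2).

Lemma swapF_E : swapF = mx4 [:: [:: 1; 0; 0; 0]; [:: 0; 0; 1; 0]; [:: 0; 1; 0; 0]; [:: 0; 0; 0; 1]].
Proof.
apply/matrixP => i j; rewrite /swapF /tperm_mx !mxE permE /=.
rewrite -!val_eqE /= !inordK //.
case: i => [[|[|[|[|//]]]] hi] /=; case: j => [[|[|[|[|//]]]] hj] //=;
by rewrite -?val_eqE /= ?inordK.
Qed.

(* Columns: [e00], [(e01 + e10)/sqrt 2], [e11] and the singlet [(e01 - e10)/sqrt 2]. *)
Definition bell : 'M[F]_4 :=
  mx4 [:: [:: 1; 0; 0; 0]; [:: 0; s; 0; s]; [:: 0; s; 0; - s]; [:: 0; 0; 1; 0]].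

Lemma bell_unitary : bell \is unitarymx.
Proof.
apply/unitarymxP; apply/matrixP => i j; rewrite !mxE !big_ord_recl big_ord0 !mxE.
have hs := rsqrt2_sqr; have hr := rsqrt2_real.
case: i => [[|[|[|[|//]]]] hi] /=; case: j => [[|[|[|[|//]]]] hj] /=;
rewrite /= ?(rmorphN, rmorph0, rmorph1) /= ?hr
  ?(mulr0, mul0r, mulr1, mul1r, addr0, add0r, mulrNN, mulrN, mulNr) ?hs //; by field.
Qed.

Definition parity : 'M[F]_(3 + 1) := block_mx 1%:M 0 0 (- 1%:M).

Lemma parityE : parity = mx4 [:: [:: 1; 0; 0; 0]; [:: 0; 1; 0; 0]; [:: 0; 0; 1; 0]; [:: 0; 0; 0; -1]].
Proof.
apply/matrixP => i j; rewrite [LHS]mxE.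
case: (splitP i) => i' ei; rewrite mxE; case: (splitP j) => j' ej; rewrite !mxE ei ej.
- by case: i' {ei} => [[|[|[|//]]] hi]; case: j' {ej} => [[|[|[|//]]] hj].
- by rewrite [j']ord1; case: i' {ei} => [[|[|[|//]]] hi].
- by rewrite [i']ord1; case: j' {ej} => [[|[|[|//]]] hj].
- by rewrite [i']ord1 [j']ord1.
Qed.

Lemma swap_bell : swapF *m bell = bell *m (parity : 'M[F]_4).
Proof.
rewrite swapF_E parityE; apply/matrixP => i j; rewrite !mxE !big_ord_recl !big_ord0 !mxE.
case: i => [[|[|[|[|//]]]] hi] /=; case: j => [[|[|[|[|//]]]] hj] /=; by ring.
Qed.

Definition arrow_form (a : 'I_3 -> F) (b : 'cV[F]_3) (c : F) : 'M[F]_(3 + 1) :=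
  block_mx (diag_mx (\row_k a k)) b (b^t*) c%:M.

(* [K (x) 1 - 1 (x) K] maps the singlet to the triplet space, and
   [Z (x) 1 + 1 (x) Z] has eigenvalues [2, 0, -2] there. *)
Lemma local_bell (c l x y : F) : c \is Num.real -> l \is Num.real ->
  x \is Num.real -> y \is Num.real ->
  exists H1 H2 : 'M[F]_2, [/\ H1 \is hermsymmx, H2 \is hermsymmx &
    (H1 *t (1%:M : 'M[F]_2) + (1%:M : 'M[F]_2) *t H2) *m bell =
    bell *m mx4 [:: [:: c + l; 0; 0; x]; [:: 0; c; 0; y]; [:: 0; 0; c - l; - x]; [:: x; y; - x; c]]].
Proof.
move=> /realCi cr /realCi lr /realCi xr /realCi yr.
have hs := rsqrt2_sqr; have hr := rsqrt2_real.
have h2 : (2^-1 : F)^* = 2^-1 by rewrite fmorphV rmorph_nat.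
pose mx2 (p q r t : F) : 'M[F]_2 := \matrix_(i, j) (nth [::] [:: [:: p; q]; [:: r; t]] i)`_j.
pose w := - x * s.
(* In terms of the Pauli matrices [X], [Z], the common part [c / 2 + (l / 2) Z] gives the diagonal;
   the opposite parts [(y / 2) Z] and [w X] send the singlet to the middle triplet vector and to the
   difference of the outer two. *)
exists (mx2 ((c + l + y) / 2) w w ((c - l - y) / 2)),
       (mx2 ((c + l - y) / 2) (- w) (- w) ((c - l + y) / 2)).
have wr : w^* = w by rewrite rmorphM rmorphN /= xr hr.
split.
- apply/hermitian_trC/matrixP => i j; rewrite !mxE.
  case: i => [[|[|//]] hi] /=; case: j => [[|[|//]] hj] //=;
  by rewrite ?rmorphM /= ?h2 ?(rmorphB, rmorphD) /= ?rmorphB ?rmorphD ?rmorphN /= ?cr ?lr ?yr ?xr ?hr.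
- apply/hermitian_trC/matrixP => i j; rewrite !mxE.
  case: i => [[|[|//]] hi] /=; case: j => [[|[|//]] hj] //=;
  by rewrite ?rmorphN /= ?rmorphM /= ?h2 ?(rmorphB, rmorphD) /= ?rmorphB ?rmorphD ?rmorphN /=
             ?cr ?lr ?yr ?xr ?hr.
apply/matrixP => i j; rewrite !mxE !big_ord_recl !big_ord0 !mxE /w.
case: i => [[|[|[|[|//]]]] hi] /=; case: j => [[|[|[|[|//]]]] hj] /=;
rewrite -?val_eqE /=.
all: try by field.
- by rewrite [LHS](_ : _ = 2 * x * (s * s)); [rewrite hs; field | ring].
- by rewrite [LHS](_ : _ = - (2 * x * (s * s))); [rewrite hs; field | ring].
Qed.

Lemma arrow_formE a b c :
  arrow_form a b c = mx4 [::
    [:: a 0; 0; 0; b 0 0]; [:: 0; a 1; 0; b 1 0]; [:: 0; 0; a 2; b 2 0];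
    [:: (b 0 0)^*; (b 1 0)^*; (b 2 0)^*; c]].
Proof.
have o1 (h : (1 < 3)%N) : Ordinal h = 1 by exact: val_inj.
have o2 (h : (2 < 3)%N) : Ordinal h = 2 by exact: val_inj.
have o0 (h : (0 < 3)%N) : Ordinal h = 0 by exact: val_inj.
apply/matrixP => i j; rewrite [LHS]mxE.
case: (splitP i) => i' ei; rewrite mxE; case: (splitP j) => j' ej; rewrite !mxE ei ej.
- by case: i' {ei} => [[|[|[|//]]] hi]; case: j' {ej} => [[|[|[|//]]] hj];
  rewrite ?(o0, o1, o2) /= ?mulr1n ?mulr0n.
- by rewrite [j']ord1; case: i' {ei} => [[|[|[|//]]] hi]; rewrite ?(o0, o1, o2).
- by rewrite [i']ord1; case: j' {ej} => [[|[|[|//]]] hj]; rewrite ?(o0, o1, o2).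
- by rewrite [i']ord1 [j']ord1.
Qed.

(** In the basis [bell], the spectral theorem diagonalizes the triplet block; the correction [r]
    fixes the singlet, hence commutes with [parity]. *)
Lemma normal_form (H : 'M[F]_4) : H \is hermsymmx ->
  exists Q a b c, [/\ Q \is unitarymx, swapF *m Q = Q *m (parity : 'M[F]_4),
    H *m Q = Q *m (arrow_form a b c : 'M[F]_4),
    forall k, a k \is Num.real & c \is Num.real].
Proof.
move=> hH; have hW := bell_unitary.
pose N : 'M[F]_(3 + 1) := bell^t* *m H *m bell.
have hN : N^t* = N.
  rewrite /N !trmx_mul !map_mxM trmxCK; move/hermitian_trC: hH => ->.
  by rewrite mulmxA.
pose A : 'M[F]_3 := ulsubmx N; pose b0 : 'cV[F]_3 := ursubmx N.
have hA : A \is hermsymmx.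
  by apply/hermitian_trC; rewrite trmx_ulsub map_ulsubmx hN.
have hP := spectral_unitarymx A; set P := spectralmx A in hP.
have /orthomx_spectralP eA := hermitian_normalmx hA; rewrite -/P (invmx_unitary hP) in eA.
have hb : dlsubmx N = b0^t* by rewrite trmx_ursub map_dlsubmx hN.
pose r : 'M[F]_(3 + 1) := block_mx (P^t*) 0 0 1%:M.
have hPP : P *m P^t* = 1%:M by exact/unitarymxP.
have hPP' : P^t* *m P = 1%:M.
  by apply: mulmx1C; exact/unitarymxP.
have trr : r^t* = block_mx P 0 0 1%:M.
  by rewrite /r tr_block_mx map_block_mx trmxCK !trmx0 !map_mx0 trmx1 map_mx1.
have hr : r \is unitarymx.
  apply/unitarymxP; rewrite trr /r mulmx_block !mulmx0 !mul0mx !addr0 !add0r.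
  by rewrite hPP' mulmx1 -scalar_mx_block.
have hWW : bell *m bell^t* = 1%:M by exact/unitarymxP.
exists (bell *m r), (fun k => spectral_diag A 0 k), (P *m b0), (drsubmx N 0 0); split.
- exact: (@mul_unitarymx _ 4 4 4 _ _ hW hr).
- have e : parity *m r = r *m parity.
    rewrite /parity /r [LHS]mulmx_block [RHS]mulmx_block !mulmx0 !mul0mx !addr0 !add0r.
    by rewrite !mul1mx !mulmx1.
  by rewrite mulmxA swap_bell -!mulmxA; congr (_ *m _); exact: e.
- have -> : H *m (bell *m r) = bell *m (N *m r).
    by rewrite /N !mulmxA hWW mul1mx.
  have e : N *m r = r *m arrow_form (fun k => spectral_diag A 0 k) (P *m b0) (drsubmx N 0 0).
    rewrite -[X in X *m r = _]submxK hb -/A -/b0 /arrow_form /r.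
    rewrite [LHS]mulmx_block [RHS]mulmx_block !mulmx0 !mul0mx !addr0 !add0r !mulmx1 !mul1mx.
    rewrite mulmxA hPP' mul1mx trmx_mul map_mxM -mx11_scalar; congr block_mx.
    rewrite [X in X *m _ = _]eA -(mulmxA _ P) hPP mulmx1; congr (_ *m diag_mx _).
    by apply/rowP => k; rewrite mxE.
  by rewrite -[in RHS]mulmxA; congr (_ *m _); exact: e.
- by move=> k; have /mxOverP := hermitian_spectral_diag_real hA; apply.
- apply/CrealP; have /matrixP/(_ (rshift 3 0) (rshift 3 0)) := hN.
  by rewrite !mxE.
Qed.

(** * Shared eigenvectors and locality read off the normal form *)

Section Consequences.
Variables (H Q : 'M[F]_4) (a : 'I_3 -> F) (b : 'cV[F]_3) (c : F).
Hypothesis hQ : Q \is unitarymx.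
Hypothesis TQ : swapF *m Q = Q *m (parity : 'M[F]_4).
Hypothesis HQ : H *m Q = Q *m (arrow_form a b c : 'M[F]_4).

(** A triplet eigenvector orthogonal to [b] is not coupled to the singlet, and the swap gate fixes
    the whole triplet space. *)
Lemma shared_of_kernel (v : 'cV[F]_3) (l : F) : v != 0 ->
  diag_mx (\row_k a k) *m v = l *: v -> b^t* *m v = 0 ->
  exists x : 'cV[F]_4, [/\ x != 0, H *m x = l *: x & swapF *m x = x].
Proof.
move=> v0 hv bv; pose x : 'cV[F]_4 := Q *m (col_mx v (0 : 'cV_1)).
exists x; split.
- apply: contraNneq v0 => x0; have := congr1 (mulmx (Q^t*)) x0.
  rewrite mulmx0 /x mulmxA (mulmx1C (unitarymxP hQ)) mul1mx => h.
  by rewrite -(col_mxKu v (0 : 'cV[F]_1)) [col_mx v 0]h linear0.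
- have e : arrow_form a b c *m col_mx v (0 : 'cV_1) = l *: col_mx v 0.
    rewrite /arrow_form mul_block_col hv bv !mulmx0 !addr0.
    by rewrite scale_col_mx scaler0.
  by rewrite /x mulmxA HQ -mulmxA scalemxAr; congr (_ *m _); exact: e.
- have e : parity *m col_mx v (0 : 'cV_1) = col_mx v 0.
    by rewrite /parity mul_block_col !mulmx0 mul0mx mul1mx !addr0.
  by rewrite /x mulmxA TQ -mulmxA; congr (_ *m _); exact: e.
Qed.

Lemma shared_of_zero k : b k 0 = 0 ->
  exists x : 'cV[F]_4, exists l, [/\ x != 0, H *m x = l *: x & swapF *m x = x].
Proof.
move=> bk; have [] := @shared_of_kernel (delta_mx k 0) (a k).
- by apply/negP => /eqP/matrixP/(_ k 0)/eqP; rewrite !mxE !eqxx oner_eq0.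
- apply/matrixP => i j; rewrite mul_diag_mx !mxE.
  by case: eqVneq => [->|]; rewrite ?mulr0.
- apply/matrixP => p p'; rewrite !mxE (bigD1 k) //= big1 ?addr0.
    by rewrite !mxE [p]ord1 bk rmorph0 mul0r.
  by move=> q qk; rewrite !mxE (negbTE qk) mulr0.
by move=> x hx; exists x, (a k).
Qed.

Lemma shared_of_eq i j : i != j -> a i = a j ->
  exists x : 'cV[F]_4, exists l, [/\ x != 0, H *m x = l *: x & swapF *m x = x].
Proof.
move=> ij aij; have [/eqP|bj] := boolP (b j 0 == 0); first exact: shared_of_zero.
(* A combination of two basis vectors with the same eigenvalue, orthogonal to [b], and nonzero
   because [b j 0] is. *)
pose v : 'cV[F]_3 := (b j 0)^* *: delta_mx i 0 - (b i 0)^* *: delta_mx j 0.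
have [] := @shared_of_kernel v (a i).
- apply/negP => /eqP/matrixP/(_ i 0)/eqP; rewrite !mxE !eqxx (negbTE ij) mulr0 subr0 mulr1.
  by rewrite conjC_eq0 (negbTE bj).
- apply/matrixP => p q; rewrite mul_diag_mx !mxE.
  have [->|pi] := eqVneq p i; first by [].
  by have [->|pj] := eqVneq p j; rewrite ?aij //= !mulr0 subr0 !mulr0.
- apply/matrixP => p q; rewrite !mxE (bigD1 i) //= (bigD1 j) ?(eq_sym j) //= big1 ?addr0.
    by rewrite !mxE [p]ord1 [q]ord1 !eqxx (eq_sym j i) !(negbTE ij) /= !mulr1 !mulr0; ring.
  by move=> k /andP[ki kj]; rewrite !mxE (negbTE ki) (negbTE kj) /= !mulr0 subr0 mulr0.
by move=> x hx; exists x, (a i).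
Qed.

(** The map [f] orders the triplet basis by the eigenvalues [c + l], [c], [c - l]. Rephasing the
    basis vectors turns the coupling into [(x, y, -x)] with [x], [y] real, the pattern of
    [local_bell]. *)
Lemma local_of_pair (f : 'I_3 -> 'I_3) (l : F) : injective f ->
  (forall k, a k \is Num.real) -> c \is Num.real -> l \is Num.real ->
  (forall k, b k 0 != 0) ->
  a (f 0) = c + l -> a (f 1) = c -> a (f 2) = c - l ->
  `|b (f 0) 0| = `|b (f 2) 0| ->
  exists P H1 H2, [/\ P \is unitarymx, P *m swapF = swapF *m P,
    H1 \is hermsymmx, H2 \is hermsymmx &
    H1 *t (1%:M : 'M[F]_2) + (1%:M : 'M[F]_2) *t H2 = P *m H *m P^t*].
Proof.
move=> finj areal creal lreal b0 a0 a1 a2 bb.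
pose th (m : 'I_3) : F := (if m == 2 then -1 else 1) * (`|b (f m) 0| / b (f m) 0).
have thb m : th m * b (f m) 0 = (if m == 2 then -1 else 1) * `|b (f m) 0|.
  by rewrite /th -mulrA mulfVK.
have th1 m : th m * (th m)^* = 1.
  have e1 : (if m == 2 then -1 else 1 : F) * (if m == 2 then -1 else 1)^* = 1.
    by case: ifP => _; rewrite ?rmorphN rmorph1 ?mulrNN mul1r.
  rewrite /th rmorphM /= mulrACA e1 mul1r -normCK normf_div normr_id.
  by rewrite divff ?normr_eq0 // expr1n.
pose Th : 'M[F]_3 := \matrix_(m, k) (th m *+ (k == f m)).
have hTh : Th *m Th^t* = 1%:M.
  apply/matrixP => m m'; rewrite !mxE (bigD1 (f m)) //= big1 ?addr0 => [|k kf].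
    rewrite !mxE eqxx mulr1n (inj_eq finj).
    by case: eqVneq => [->|]; rewrite ?th1 // mulr0n rmorph0 mulr0.
  by rewrite !mxE (negbTE kf) mulr0n mul0r.
pose x := `|b (f 0) 0|; pose y := `|b (f 1) 0|.
have [H1 [H2 [h1 h2 hL]]] := local_bell creal lreal (normr_real (b (f 0) 0)) (normr_real (b (f 1) 0)).
have r4 := @arrow_formE (a \o f) (Th *m b) c.
pose r : 'M[F]_(3 + 1) := block_mx Th 0 0 1%:M.
have trr : r^t* = block_mx (Th^t*) 0 0 1%:M.
  by rewrite /r tr_block_mx map_block_mx !trmx0 !map_mx0 trmx1 map_mx1.
have hr : r \is unitarymx.
  apply/unitarymxP; rewrite trr /r mulmx_block !mulmx0 !mul0mx !addr0 !add0r.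
  by rewrite hTh mulmx1 -scalar_mx_block.
have rpar : parity *m r = r *m parity.
  rewrite /parity /r [LHS]mulmx_block [RHS]mulmx_block !mulmx0 !mul0mx !addr0 !add0r.
  by rewrite !mul1mx !mulmx1.
have rN : r *m arrow_form a b c = arrow_form (a \o f) (Th *m b) c *m r.
  rewrite /arrow_form /r [LHS]mulmx_block [RHS]mulmx_block !mulmx0 !mul0mx !addr0 !add0r.
  rewrite !mul1mx !mulmx1 trmx_mul map_mxM -mulmxA (mulmx1C hTh) mulmx1; congr block_mx.
  apply/matrixP => m k; rewrite mul_mx_diag mul_diag_mx !mxE /=.
  by case: eqVneq => [->|]; rewrite ?mulr1n ?mulr0n ?mul0r ?mulr0 // mulrC.
have Thb m : (Th *m b) m 0 = th m * b (f m) 0.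
  rewrite mxE (bigD1 (f m)) //= big1 ?addr0 => [|k kf]; first by rewrite mxE eqxx mulr1n.
  by rewrite mxE (negbTE kf) mulr0n mul0r.
have realN z : z^* = z -> (- z)^* = - z by move=> e; rewrite rmorphN /= e.
have N4 : (arrow_form (a \o f) (Th *m b) c : 'M[F]_4) =
    mx4 [:: [:: c + l; 0; 0; x]; [:: 0; c; 0; y]; [:: 0; 0; c - l; - x]; [:: x; y; - x; c]].
  rewrite r4 !Thb !thb /= a0 a1 a2 -bb -/x -/y !mul1r mulN1r.
  by rewrite rmorphN /= !(realCi (normr_real _)).
have hW := bell_unitary; have hWW : bell *m bell^t* = 1%:M by exact/unitarymxP.
have hWW' := mulmx1C hWW; have hQQ := unitarymxP hQ; have hQQ' := mulmx1C hQQ.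
have hr4 : (r : 'M[F]_4) *m (r : 'M[F]_4)^t* = 1%:M := unitarymxP hr.
have hu : bell *m (r : 'M[F]_4) *m Q^t* \is unitarymx.
  apply: mul_unitarymx; last by rewrite trmxC_unitary.
  exact: (@mul_unitarymx _ 4 4 4 _ _ hW hr).
exists (bell *m (r : 'M[F]_4) *m Q^t*), H1, H2; split => //.
- have QT : Q^t* *m swapF = parity *m Q^t*.
    by rewrite -[LHS]mulmx1 -hQQ mulmxA -(mulmxA (Q^t*)) TQ !mulmxA hQQ' mul1mx.
  have e : bell *m (r : 'M[F]_4) *m (parity : 'M[F]_4) = bell *m (parity : 'M[F]_4) *m (r : 'M[F]_4).
    by rewrite -!mulmxA; congr (_ *m _); symmetry; exact: rpar.
  by rewrite -mulmxA QT !mulmxA swap_bell e.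
- have -> : H = Q *m (arrow_form a b c : 'M[F]_4) *m Q^t* by rewrite -HQ -mulmxA hQQ mulmx1.
  rewrite !trmx_mul !map_mxM trmxCK !mulmxA -(mulmxA _ (Q^t*) Q) hQQ' mulmx1.
  rewrite -(mulmxA _ (Q^t*) Q) hQQ' mulmx1 -(mulmxA bell) [r *m _]rN mulmxA.
  rewrite -(mulmxA _ (r : 'M[F]_4)) hr4 mulmx1 [arrow_form _ _ _]N4 -hL -mulmxA hWW mulmx1.
  by [].
Qed.

End Consequences.

End NormalForm.

(** * Entrywise norm and phases *)

Local Open Scope complex_scope.

Section SumNorm.
Context {R : realType}.
Local Notation C := R[i].
Import Normc.

Lemma normcE_norm (z : C) : `|z| = (normc z)%:C.
Proof. by case: z. Qed.

Lemma normc_ge0 (z : C) : 0 <= normc z.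
Proof. by case: z => a b; exact: sqrtr_ge0. Qed.

Lemma normcD (x y : C) : normc (x + y) <= normc x + normc y.
Proof. exact: le_normcD. Qed.

Lemma normc_conj (z : C) : normc (z^*)%R = normc z.
Proof. by apply: complexI; rewrite -!normcE_norm norm_conjC. Qed.

Lemma normc_real (x : R) : normc x%:C = `|x|.
Proof. by rewrite /normc /= expr0n addr0 sqrtr_sqr. Qed.

Lemma normci : normc ('i%C : C) = 1.
Proof. by rewrite /normc expr0n expr1n add0r sqrtr1. Qed.

Lemma normc_sum (I : Type) (r : seq I) (P : pred I) (F : I -> C) :
  normc (\sum_(i <- r | P i) F i) <= \sum_(i <- r | P i) normc (F i).
Proof.
elim/big_rec2: _ => [|i y x _ h]; first by rewrite normc0.
by apply: le_trans (normcD _ _) _; rewrite lerD2l.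
Qed.

(** A submultiplicative norm computed from the entries; [opnorm_le_sumnorm] and [normc_le_opnorm]
    later compare it with the operator norm. *)
Definition sumnorm m n (A : 'M[C]_(m, n)) : R := \sum_i \sum_j normc (A i j).

Lemma sumnorm_ge0 m n (A : 'M[C]_(m, n)) : 0 <= sumnorm A.
Proof. by do 2!apply: sumr_ge0 => ? _; exact: normc_ge0. Qed.

Lemma sumnorm0 m n : sumnorm (0 : 'M[C]_(m, n)) = 0.
Proof. by do 2!apply: big1 => ? _; rewrite mxE normc0. Qed.

Lemma sumnormD m n (A B : 'M[C]_(m, n)) : sumnorm (A + B) <= sumnorm A + sumnorm B.
Proof.
rewrite -big_split; apply: ler_sum => i _; rewrite -big_split.
by apply: ler_sum => j _; rewrite mxE; exact: normcD.
Qed.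

Lemma sumnormZ m n a (A : 'M[C]_(m, n)) : sumnorm (a *: A) = normc a * sumnorm A.
Proof.
rewrite mulr_sumr; apply: eq_bigr => i _; rewrite mulr_sumr.
by apply: eq_bigr => j _; rewrite mxE normcM.
Qed.

Lemma sumnormN m n (A : 'M[C]_(m, n)) : sumnorm (- A) = sumnorm A.
Proof. by do 2!apply: eq_bigr => ? _; rewrite mxE normcN. Qed.

Lemma sumnorm_trC m n (A : 'M[C]_(m, n)) : sumnorm (A^t*) = sumnorm A.
Proof.
rewrite /sumnorm exchange_big; apply: eq_bigr => i _; apply: eq_bigr => j _.
by rewrite !mxE normc_conj.
Qed.

Lemma sumnormM m n p (A : 'M[C]_(m, n)) (B : 'M[C]_(n, p)) :
  sumnorm (A *m B) <= sumnorm A * sumnorm B.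
Proof.
rewrite mulr_suml; apply: ler_sum => i _.
apply: (@le_trans _ _ (\sum_k \sum_j normc (A i j) * normc (B j k))).
  apply: ler_sum => k _; rewrite mxE; apply: le_trans (normc_sum _ _ _) _.
  by apply: ler_sum => j _; rewrite normcM.
rewrite exchange_big mulr_suml; apply: ler_sum => j _.
rewrite -mulr_sumr ler_wpM2l ?normc_ge0 // [leRHS](bigD1 j) //= lerDl.
by do 2!apply: sumr_ge0 => ? _; exact: normc_ge0.
Qed.

Lemma unitary_normc_le1 n (U : 'M[C]_n) i j : U \is unitarymx -> normc (U i j) <= 1.
Proof.
move=> /unitarymxP /matrixP /(_ i i); rewrite !mxE eqxx (bigD1 j) //= !mxE.
move=> e; have : normc (U i j) ^+ 2 <= 1.
  rewrite -lecR rmorphXn /= -normcE_norm normCK -[leRHS]/(1 : C) -[leRHS]e lerDl.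
  by apply: sumr_ge0 => k _; rewrite !mxE mul_conjC_ge0.
by rewrite -{1}(expr1n _ 2%N) ler_pXn2r // nnegrE ?normc_ge0.
Qed.

(** Each entry of a unitary matrix has modulus at most one. This is the source of the constants [c]
    in the estimates below. *)
Lemma sumnorm_unitary n (U : 'M[C]_n) : U \is unitarymx -> sumnorm U <= (n * n)%:R.
Proof.
move=> hU; apply: (@le_trans _ _ (\sum_(i < n) \sum_(j < n) 1)).
  by do 2!apply: ler_sum => ? _; exact: unitary_normc_le1.
by rewrite sumr_const card_ord sumr_const card_ord -mulrnA.
Qed.

Lemma sumnormM_unitaryr m n (A : 'M[C]_(m, n)) (U : 'M[C]_n) : U \is unitarymx ->
  sumnorm (A *m U) <= sumnorm A * (n * n)%:R.
Proof.
move=> hU; apply: le_trans (sumnormM _ _) _.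
by rewrite ler_wpM2l ?sumnorm_ge0 // (sumnorm_unitary hU).
Qed.

Lemma sumnormM_unitaryl m n (U : 'M[C]_n) (A : 'M[C]_(n, m)) : U \is unitarymx ->
  sumnorm (U *m A) <= (n * n)%:R * sumnorm A.
Proof.
move=> hU; apply: le_trans (sumnormM _ _) _.
by rewrite ler_wpM2r ?sumnorm_ge0 // (sumnorm_unitary hU).
Qed.

Lemma sumnorm_sandwich n (U V A : 'M[C]_n) : U \is unitarymx -> V \is unitarymx ->
  sumnorm (U *m A *m V) <= (n * n)%:R * sumnorm A * (n * n)%:R.
Proof.
move=> hU hV; apply: le_trans (sumnormM_unitaryr _ hV) _.
by rewrite ler_wpM2r // sumnormM_unitaryl.
Qed.

Lemma unitary1 n : (1%:M : 'M[C]_n) \is unitarymx.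
Proof. by apply/unitarymxP; rewrite trmx1 map_mx1 mulmx1. Qed.

End SumNorm.

(** * The scalar exponential [e^(-ix)] *)

Section Phase.
Context {R : realType}.
Local Notation C := R[i].
Import Normc.

Definition phase (x : R) : C := cos x -i* sin x.

Lemma phaseD x y : phase (x + y) = phase x * phase y.
Proof.
by rewrite /phase cosD sinD; simpc; congr (_ +i* _); rewrite ?opprD addrC.
Qed.

Lemma phase0 : phase 0 = 1.
Proof. by rewrite /phase cos0 sin0 oppr0. Qed.

Lemma phaseMn x n : phase (x *+ n) = phase x ^+ n.
Proof. by elim: n => [|n IH]; rewrite ?phase0 // mulrS phaseD IH exprS. Qed.

Lemma phase_conj x : ((phase x)^*)%R = phase (- x).
Proof. by rewrite /phase cosN sinN. Qed.

Lemma phase_mul_conj x : phase x * (phase x)^* = 1.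
Proof. by rewrite phase_conj -phaseD subrr phase0. Qed.

(** The angle [acos a] has the right cosine, and the right sine up to sign; negating the angle
    corrects the sign. *)
Lemma phase_surj (z : C) : z * z^* = 1 -> exists x, z = phase x.
Proof.
case: z => a b; rewrite -[(_ ^*)%R]/(a -i* b); simpc => - [ab _].
have a1 : -1 <= a <= 1 by nra.
have sa : sin (acos a) ^+ 2 = b ^+ 2.
  by rewrite sin_acos // sqr_sqrtr; nra.
have ca : cos (acos a) = a by rewrite acosK // in_itv.
have /orP[/eqP e|/eqP e] : (sin (acos a) == b) || (sin (acos a) == - b).
- by rewrite -eqf_sqr sa.
- by exists (- acos a); rewrite /phase cosN sinN ca e opprK.
- by exists (acos a); rewrite /phase ca e opprK.
Qed.

Lemma abs_sin_le (x : R) : `|sin x| <= `|x|.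
Proof.
wlog x0 : x / 0 <= x => [hw|].
  have [/hw //|/ltW x0] := leP 0 x.
  by rewrite -normrN -sinN -[leRHS]normrN; apply: hw; rewrite oppr_ge0.
move: x0; rewrite le_eqVlt => /orP[/eqP <-|x0]; first by rewrite sin0.
have [c _ e] := @MVT R sin cos 0 x x0 (fun y _ => is_derive_sin y)
  (continuous_subspaceT (@continuous_sin R)).
rewrite -[sin x]subr0 -sin0 e subr0 normrM -[leRHS]mul1r.
by rewrite ler_wpM2r // cos_max.
Qed.

Lemma one_sub_cos (x : R) : 1 - cos x = 2 * sin (x / 2) ^+ 2.
Proof.
rewrite {1}(_ : x = (x / 2) *+ 2); last by rewrite -mulr_natr; field.
by rewrite cos_mulr2n -mulr_natr sin2cos2; ring.
Qed.

Lemma one_sub_cos_le (x : R) : 0 <= 1 - cos x <= `|x|.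
Proof.
rewrite subr_ge0 cos_le1 /= one_sub_cos -real_normK ?num_real // expr2.
have := abs_sin_le (x / 2); have := sin_max (x / 2).
rewrite normrM [`|2^-1|]ger0_norm ?invr_ge0 //.
have := normr_ge0 (sin (x / 2)); nra.
Qed.

(** Mean value theorem for [y - sin y], whose derivative [1 - cos y] is at most [|y|]. *)
Lemma abs_sub_sin_le (x : R) : `|x - sin x| <= x ^+ 2.
Proof.
wlog x0 : x / 0 <= x => [hw|].
  have [/hw //|/ltW x0] := leP 0 x.
  by rewrite -normrN opprD -sinN -sqrrN; apply: hw; rewrite oppr_ge0.
move: x0; rewrite le_eqVlt => /orP[/eqP <-|x0].
  by rewrite sin0 subr0 normr0 expr0n.
have der y : y \in `]0, x[ -> is_derive y 1 (fun z => z - sin z) (1 - cos y).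
  by move=> _; apply: is_deriveB.
have [|c cx e] := @MVT R (fun y => y - sin y) (fun y => 1 - cos y) 0 x x0 der.
  apply: continuous_subspaceT => y; apply: continuousB; first exact: cvg_id.
  exact: continuous_sin.
have -> : x - sin x = (1 - cos c) * x by rewrite -[x in RHS]subr0 -e sin0 !subr0.
have /andP[c0 cc] := one_sub_cos_le c.
move: cx; rewrite in_itv /= => /andP[c0' cx].
rewrite normrM !ger0_norm // ?(ltW x0) // expr2 ler_wpM2r ?(ltW x0) //.
by apply: le_trans cc _; rewrite gtr0_norm ?(ltW cx).
Qed.

(** The real and imaginary errors are each at most [x ^+ 2], for every real [x] and not only near
    zero. *)
Lemma phase_taylor (x : R) : normc (phase x - 1 + 'i%C * x%:C) <= 2 * x ^+ 2.
Proof.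
have -> : phase x - 1 + 'i%C * x%:C = - (1 - cos x)%:C + 'i%C * (x - sin x)%:C.
  by rewrite /phase -[1 : C]/(1 +i* 0); simpc; congr (_ +i* _); ring.
apply: le_trans (normcD _ _) _.
rewrite normcN normcM normci mul1r !normc_real.
have h1 := abs_sub_sin_le x.
have h2 : `|1 - cos x| <= x ^+ 2.
  have /andP[c0 _] := one_sub_cos_le x; rewrite ger0_norm // one_sub_cos.
  have := abs_sin_le (x / 2); rewrite -ler_sqr ?nnegrE // !real_normK ?num_real //.
  rewrite expr_div_n; have := sqr_ge0 x; lra.
lra.
Qed.

Local Notation CN := (R[i] : numFieldType).

Lemma cvg_complex (u v : R ^nat) (a b : R) :
  u @ \oo --> a -> v @ \oo --> b -> (fun n => u n +i* v n : CN) @ \oo --> (a +i* b : CN).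
Proof.
move=> ua vb; apply/cvgrPdist_lt => e e0.
have [e' e'0 ee] : exists2 e' : R, 0 < e' & e = e'%:C.
  exists (complex.Re e); last by rewrite (RRe_real (gtr0_real e0)).
  by move: e0; rewrite ltcE => /andP[].
have e2 : 0 < e' / 2 by rewrite divr_gt0.
near=> n.
have hu : `|a - u n| < e' / 2 by near: n; exact: (cvgr_dist_lt _ _ ua _ e2).
have hv : `|b - v n| < e' / 2 by near: n; exact: (cvgr_dist_lt _ _ vb _ e2).
rewrite normcE_norm ee ltcR.
have -> : (a +i* b) - (u n +i* v n) = (a - u n)%:C + 'i%C * (b - v n)%:C.
  by simpc.
apply: le_lt_trans (normcD _ _) _.
rewrite normcM normci mul1r !normc_real.
lra.
Unshelve. all: by end_near.
Qed.

(** Even powers of [-ix] are real and odd ones imaginary; term by term they give the cosine series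
    and minus the sine series. *)
Lemma cvg_phase (x : R) :
  series (fun k => (k`!%:R)^-1 * (- 'i%C * x%:C) ^+ k : CN) @ \oo --> (phase x : CN).
Proof.
have -> : series (fun k => (k`!%:R)^-1 * (- 'i%C * x%:C) ^+ k : CN) =
  (fun n => series (cos_coeff x) n -i* series (sin_coeff x) n).
  apply/funext => n; rewrite /series /=.
  elim: n => [|n IH]; first by rewrite !big_geq // oppr0.
  rewrite !big_nat_recr //= IH opprD.
  have -> : (n`!%:R)^-1 * (- 'i%C * x%:C) ^+ n = cos_coeff x n -i* sin_coeff x n.
    have i2 k : (- 'i%C * x%:C) ^+ k.*2 = ((-1) ^+ k * x ^+ k.*2)%:C.
      have e : (- 'i%C * x%:C) ^+ 2 = (- x ^+ 2)%:C.
        by rewrite exprMn sqrrN sqr_i mulN1r -rmorphXn -rmorphN.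
      by rewrite -mul2n !exprM e -rmorphXn -exprMn mulN1r.
    have inj (k : nat) : ((k`!%:R)^-1 : C) = (k`!%:R^-1)%:C.
      by rewrite fmorphV rmorph_nat.
    rewrite /cos_coeff /sin_coeff /= inj -{2}(odd_double_half n).
    case: (boolP (odd n)) => hn /=.
      have -> : n.-1./2 = n./2 by rewrite -{1}(odd_double_half n) hn /= doubleK.
      rewrite add1n exprS i2; simpc; congr (_ +i* _).
      have -> : x ^+ n = x * x ^+ n./2.*2.
        by rewrite -exprS -[in LHS](odd_double_half n) hn add1n.
      ring.
    rewrite add0n i2; simpc; congr (_ +i* _).
    have -> : x ^+ n./2.*2 = x ^+ n.
      by rewrite -[in RHS](odd_double_half n) (negbTE hn) add0n.
    by rewrite -exprnP; ring.
  by simpc.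
apply: cvg_complex.
  by rewrite unlock; exact: is_cvg_series_cos_coeff.
by apply: cvgN; rewrite unlock; exact: is_cvg_series_sin_coeff.
Qed.

End Phase.

(** * The evolution operator *)

Lemma cvg_mx (K : numFieldType) (m n : nat) (F : nat -> 'M[K]_(m, n)) (L : 'M[K]_(m, n)) :
  (forall i j, (fun k => F k i j) @ \oo --> L i j) -> F @ \oo --> L.
Proof.
move=> h; apply/cvg_ballP => e e0.
have : \forall k \near \oo, forall i j, ball (L i j) e (F k i j).
  apply: filter_forall => i; apply: filter_forall => j.
  exact: (cvg_ball (h i j)).
by apply: filterS => k hk; split => // i j; exact: hk.
Qed.

(** For a fixed unitary [P] this is an algebra homomorphism in [d], so powers, adjoints and
    exponentials are computed on the eigenvalues. *)
HB.lock Definition udiag {F : numClosedFieldType} {n : nat}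
  (P : 'M[F]_n.+1) (d : 'rV[F]_n.+1) : 'M[F]_n.+1 := P^t* *m diag_mx d *m P.
Canonical udiag_unlockable := Unlockable udiag.unlock.

Section UDiag.
Context {F : numClosedFieldType} {n : nat}.
Implicit Types (P U : 'M[F]_n.+1) (d e : 'rV[F]_n.+1).

Lemma udiagE P d i j : udiag P d i j = \sum_k (P^t*) i k * d 0 k * P k j.
Proof. by rewrite unlock mxE; apply: eq_bigr => k _; rewrite mul_mx_diag mxE. Qed.

Lemma udiagD P d e : udiag P (d + e) = udiag P d + udiag P e.
Proof. by rewrite [@udiag]unlock linearD /= mulmxDr mulmxDl. Qed.

Lemma udiagZ P a d : udiag P (a *: d) = a *: udiag P d.
Proof. by rewrite [@udiag]unlock linearZ /= -scalemxAr -scalemxAl. Qed.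

Lemma unitarymx_trCmul P : P \is unitarymx -> P^t* *m P = 1%:M.
Proof. by rewrite -trmxC_unitary => /unitarymxP; rewrite trmxCK. Qed.

Lemma udiag1 P : P \is unitarymx -> udiag P (const_mx 1) = 1.
Proof. by move=> hP; rewrite [@udiag]unlock diag_const_mx mulmx1 unitarymx_trCmul. Qed.

Lemma udiagM P d e : P \is unitarymx ->
  udiag P d *m udiag P e = udiag P (\row_k (d 0 k * e 0 k)).
Proof.
move=> /unitarymxP hP; rewrite [@udiag]unlock -(mulmx_diag d e) !mulmxA.
by rewrite -(mulmxA _ P) hP mulmx1.
Qed.

Lemma udiagX P d k : P \is unitarymx ->
  udiag P d ^+ k = udiag P (\row_i (d 0 i ^+ k)).
Proof.
move=> hP; elim: k => [|k IH].
  rewrite expr0 -(udiag1 hP); congr udiag.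
  by apply/rowP => i; rewrite !mxE expr0.
rewrite exprS IH [_ * _](udiagM _ _ hP); congr udiag.
by apply/rowP => i; rewrite !mxE exprS.
Qed.

Lemma udiag_trC P d : (udiag P d)^t* = udiag P (map_mx Num.conj d).
Proof.
by rewrite [@udiag]unlock !trmx_mul !map_mxM trmxCK tr_diag_mx map_diag_mx mulmxA.
Qed.

Lemma udiag_unitary P d : P \is unitarymx ->
  (forall k, d 0 k * (d 0 k)^* = 1) -> udiag P d \is unitarymx.
Proof.
move=> hP hd; apply/unitarymxP; rewrite udiag_trC (udiagM _ _ hP) -[RHS](udiag1 hP).
by congr udiag; apply/rowP => k; rewrite !mxE.
Qed.

(** A unitary matrix is normal, hence unitarily diagonalizable; unitarity read in the eigenbasis
    gives eigenvalues of modulus one. *)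
Lemma unitary_udiag U : U \is unitarymx ->
  exists P d, [/\ P \is unitarymx, U = udiag P d & forall k, d 0 k * (d 0 k)^* = 1].
Proof.
move=> hU; have hP := spectral_unitarymx U.
have e : U = udiag (spectralmx U) (spectral_diag U).
  rewrite [@udiag]unlock -(invmx_unitary hP); apply/orthomx_spectralP/normalmxP.
  by rewrite (unitarymx_trCmul hU); apply/unitarymxP.
exists (spectralmx U), (spectral_diag U); split => // k.
have /unitarymxP := hU; rewrite {1 2}e udiag_trC (udiagM _ _ hP) [@udiag]unlock.
move=> /(congr1 (fun X => spectralmx U *m X *m (spectralmx U)^t*)).
rewrite !mulmxA mulmx1 (unitarymxP hP) mul1mx -(mulmxA _ (spectralmx U)).
by rewrite (unitarymxP hP) mulmx1 => /matrixP /(_ k k); rewrite !mxE eqxx !mulr1n.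
Qed.

Lemma udiag_conj P U d : U *m udiag P d *m U^t* = udiag (P *m U^t*) d.
Proof. by rewrite [@udiag]unlock trmx_mul map_mxM trmxCK !mulmxA. Qed.

Lemma diag_udiag P d : P \is unitarymx -> diag_mx d = P *m udiag P d *m P^t*.
Proof.
move=> hP; rewrite [@udiag]unlock !mulmxA (unitarymxP hP) mul1mx -mulmxA.
by rewrite (unitarymxP hP) mulmx1.
Qed.

Lemma unitaryX (A : 'M[F]_n.+1) k : A \is unitarymx -> A ^+ k \is unitarymx.
Proof.
move=> hA; elim: k => [|k IH].
  by rewrite expr0; apply/unitarymxP; rewrite trmx1 map_mx1 mulmx1.
by rewrite exprS; exact: mul_unitarymx.
Qed.

Lemma hermD (K L : 'M[F]_n.+1) :
  K \is hermsymmx -> L \is hermsymmx -> K + L \is hermsymmx.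
Proof.
move=> /hermitian_trC hK /hermitian_trC hL; apply/hermitian_trC.
by rewrite linearD map_mxD /= hK hL.
Qed.

Lemma hermN (K : 'M[F]_n.+1) : K \is hermsymmx -> - K \is hermsymmx.
Proof. by move=> /hermitian_trC hK; apply/hermitian_trC; rewrite linearN map_mxN /= hK. Qed.

Lemma herm_conj (K U : 'M[F]_n.+1) :
  K \is hermsymmx -> (U *m K *m U^t*) \is hermsymmx.
Proof.
move=> /hermitian_trC hK; apply/hermitian_trC.
by rewrite !trmx_mul !map_mxM trmxCK hK mulmxA.
Qed.

End UDiag.

HB.lock Definition spec {R : realType} {n : nat}
  (P : 'M[R[i]]_n.+1) (t : 'rV[R]_n.+1) : 'M[R[i]]_n.+1 :=
  udiag P (map_mx (real_complex R) t).
Canonical spec_unlockable := Unlockable spec.unlock.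

HB.lock Definition evol {R : realType} {n : nat} (K : 'M[R[i]]_n.+1) : 'M[R[i]]_n.+1 :=
  expmx (- 'i%C *: K).
Canonical evol_unlockable := Unlockable evol.unlock.

HB.lock Definition phases {R : realType} {n : nat} (t : 'rV[R]_n.+1) : 'rV[R[i]]_n.+1 :=
  map_mx phase t.
Canonical phases_unlockable := Unlockable phases.unlock.

Section Expmx.
Context {R : realType} {n : nat}.
Local Notation C := R[i].
Implicit Types (P U : 'M[C]_n.+1) (t : 'rV[R]_n.+1) (K : 'M[C]_n.+1).
Import Normc.

Lemma specE P t : spec P t = udiag P (map_mx (real_complex R) t).
Proof. by rewrite [@spec]unlock. Qed.

Lemma phasesE t k : phases t 0 k = phase (t 0 k).
Proof. by rewrite unlock mxE. Qed.

(** Partial sums of the matrix series are diagonal in the eigenbasis, so each entry is a finite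
    combination of scalar series covered by [cvg_phase]. *)
Lemma evol_spec P t : P \is unitarymx -> evol (spec P t) = udiag P (phases t).
Proof.
move=> hP; rewrite [@evol]unlock /expmx.
apply: (@cvg_lim 'M[(R[i] : numFieldType)]_n.+1); first exact: norm_hausdorff.
apply: cvg_mx => i j.
rewrite udiagE.
have -> : (fun k : nat => series (fun k => k`!%:R^-1 *: (- 'i%C *: spec P t) ^+ k) k i j) =
  (fun N : nat => \sum_k ((P^t*) i k *
     series (fun l => (l`!%:R)^-1 * (- 'i%C * (t 0 k)%:C) ^+ l) N) * P k j).
  apply/funext => N; rewrite /series /= summxE.
  transitivity (\sum_(0 <= l < N) \sum_k (P^t*) i k *
      (l`!%:R^-1 * (- 'i%C * (t 0 k)%:C) ^+ l) * P k j).
    apply: eq_bigr => l _; rewrite specE -udiagZ (udiagX _ _ hP) -udiagZ udiagE.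
    by apply: eq_bigr => k _; rewrite !mxE.
  rewrite exchange_big /=; apply: eq_bigr => k _.
  by rewrite mulr_sumr mulr_suml.
apply: (@cvg_big (R[i] : numFieldType) _ +%R 0 xpredT _ _ _ _
  (fun k N => (P^t*) i k * _ N * P k j) (fun k => (P^t*) i k * _ * P k j)).
  exact: (@add_continuous (R[i] : numFieldType)).
move=> k _; apply: (@cvgMr_tmp (R[i] : numFieldType)); apply: (@cvgMl_tmp (R[i] : numFieldType)).
by rewrite phasesE; exact: cvg_phase.
Qed.

Lemma spec_herm P t : spec P t \is hermsymmx.
Proof.
apply/hermitian_trC; rewrite specE udiag_trC; congr udiag.
by apply/rowP => k; rewrite !mxE; exact: conjc_real.
Qed.

Lemma herm_spec K : K \is hermsymmx ->
  exists P t, P \is unitarymx /\ K = spec P t.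
Proof.
move=> hK; exists (spectralmx K), (map_mx (@complex.Re R) (spectral_diag K)).
have hP := spectral_unitarymx K; split; first exact: hP.
have /orthomx_spectralP e := hermitian_normalmx hK.
have e' : K = udiag (spectralmx K) (spectral_diag K).
  by rewrite [@udiag]unlock -(invmx_unitary hP).
rewrite [LHS]e' specE; congr udiag.
apply/rowP => k; rewrite !mxE RRe_real //.
by have /mxOverP := hermitian_spectral_diag_real hK; apply.
Qed.

Lemma unitary_evol U : U \is unitarymx ->
  exists2 K, K \is hermsymmx & U = evol K.
Proof.
move=> /unitary_udiag [P [d [hP -> hd]]].
have [t ht] := choice (fun k => phase_surj (hd k)).
exists (spec P (\row_k t k)); first exact: spec_herm.
rewrite (evol_spec _ hP); congr udiag; apply/rowP => k; by rewrite phasesE mxE ht.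
Qed.

Lemma specZ P t (a : R) : a%:C *: spec P t = spec P (a *: t).
Proof.
rewrite !specE -udiagZ; congr udiag; apply/rowP => k.
by rewrite !mxE rmorphM.
Qed.

Lemma hermZ K (a : R) : K \is hermsymmx -> a%:C *: K \is hermsymmx.
Proof. by move=> /herm_spec[P [t [_ ->]]]; rewrite specZ; exact: spec_herm. Qed.

Lemma evol_unitary K : K \is hermsymmx -> evol K \is unitarymx.
Proof.
move=> /herm_spec[P [t [hP ->]]]; rewrite (evol_spec _ hP).
by apply: (udiag_unitary hP) => k; rewrite phasesE; exact: phase_mul_conj.
Qed.

Lemma evol_trC K : K \is hermsymmx -> (evol K)^t* = evol (- K).
Proof.
move=> /herm_spec[P [t [hP ->]]].
rewrite -(scaleN1r (spec P t)) (_ : -1 = (-1)%:C); last by rewrite rmorphN1.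
rewrite specZ !(evol_spec _ hP) udiag_trC; congr udiag; apply/rowP => k.
by rewrite [LHS]mxE !phasesE phase_conj mxE mulN1r.
Qed.

Lemma evol_root K k : K \is hermsymmx -> evol K = evol ((k.+1%:R^-1)%:C *: K) ^+ k.+1.
Proof.
move=> /herm_spec[P [t [hP ->]]]; rewrite specZ !(evol_spec _ hP) (udiagX _ _ hP).
congr udiag; apply/rowP => i; rewrite [RHS]mxE !phasesE -phaseMn; congr phase.
by rewrite mxE -mulrnAl -[X in X * _]mulr_natr mulVf ?mul1r // pnatr_eq0.
Qed.

Lemma evol_conj K U : K \is hermsymmx -> U \is unitarymx ->
  evol (U *m K *m U^t*) = U *m evol K *m U^t*.
Proof.
move=> /herm_spec[P [t [hP ->]]] hU.
have hU' : U^t* \is unitarymx by rewrite trmxC_unitary.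
have hPU := mul_unitarymx hP hU'.
by rewrite (evol_spec _ hP) udiag_conj specE udiag_conj -specE (evol_spec _ hPU).
Qed.

Let c : R := (n.+1 * n.+1)%:R.

Lemma sumnorm_udiag P d : P \is unitarymx ->
  sumnorm (udiag P d) <= c * (\sum_k normc (d 0 k)) * c.
Proof.
move=> hP; have hP' : P^t* \is unitarymx by rewrite trmxC_unitary.
rewrite unlock; apply: le_trans (sumnorm_sandwich _ hP' hP) _.
rewrite ler_wpM2r // ler_wpM2l //.
rewrite /sumnorm; apply: ler_sum => i _; rewrite (bigD1 i) //= mxE eqxx mulr1n.
by rewrite big1 ?addr0 // => j ji; rewrite mxE eq_sym (negbTE ji) mulr0n normc0.
Qed.

Lemma sumnorm_spec P t : P \is unitarymx ->
  \sum_k `|t 0 k| <= c * sumnorm (spec P t) * c.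
Proof.
move=> hP.
have e := diag_udiag (map_mx (real_complex R) t) hP.
apply: (@le_trans _ _ (sumnorm (diag_mx (map_mx (real_complex R) t)))).
  apply: ler_sum => i _; rewrite (bigD1 i) //= !mxE eqxx mulr1n normc_real lerDl.
  by apply: sumr_ge0 => *; exact: normc_ge0.
have hP' : P^t* \is unitarymx by rewrite trmxC_unitary.
by rewrite e -specE; exact: sumnorm_sandwich hP hP'.
Qed.

(** The constant is uniform in [K]: [phase_taylor] is applied to the eigenvalues, and
    [sumnorm_udiag] and [sumnorm_spec] pay for passing between [K] and its spectrum. *)
Lemma evol_taylor : exists2 M : R, 0 <= M &
  forall K, K \is hermsymmx -> sumnorm (evol K - (1 - 'i%C *: K)) <= M * sumnorm K ^+ 2.
Proof.
have c0 : 0 <= c by [].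
exists (c * 2 * c * (c * c) ^+ 2); first by rewrite !mulr_ge0 ?exprn_ge0 ?mulr_ge0.
move=> K /herm_spec[P [t [hP e]]].
have -> : evol K - (1 - 'i%C *: K) =
    udiag P (\row_k (phase (t 0 k) - 1 + 'i%C * (t 0 k)%:C)).
  rewrite -(udiag1 hP) opprB e (evol_spec _ hP) specE -udiagZ -[- udiag _ _]scaleN1r.
  rewrite -udiagZ -!udiagD; congr udiag; apply/rowP => k; rewrite [RHS]mxE -addrA.
  rewrite [LHS]mxE phasesE; congr (_ + _); rewrite !mxE; ring.
apply: le_trans (sumnorm_udiag _ hP) _.
have h1 : \sum_k normc ((\row_k (phase (t 0 k) - 1 + 'i%C * (t 0 k)%:C)) 0 k)
   <= 2 * (\sum_k `|t 0 k|) ^+ 2.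
  apply: (@le_trans _ _ (\sum_k 2 * `|t 0 k| ^+ 2)).
    by apply: ler_sum => k _; rewrite mxE real_normK ?num_real // phase_taylor.
  rewrite -mulr_sumr ler_wpM2l // expr2 mulr_suml; apply: ler_sum => k _.
  rewrite expr2 ler_wpM2l // (bigD1 k) //= lerDl.
  by apply: sumr_ge0.
have h2 := sumnorm_spec t hP; rewrite -e in h2.
have h3 : (\sum_k `|t 0 k|) ^+ 2 <= (c * sumnorm K * c) ^+ 2.
  rewrite ler_pXn2r // nnegrE ?mulr_ge0 ?sumnorm_ge0 //; exact: sumr_ge0.
apply: (@le_trans _ _ (c * (2 * (c * sumnorm K * c) ^+ 2) * c)).
  rewrite ler_wpM2r // ler_wpM2l //; apply: le_trans h1 _.
  by rewrite ler_wpM2l.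
by rewrite le_eqVlt; apply/orP; left; apply/eqP; ring.
Qed.

(** The difference telescopes into [k] terms, each [A - B] between two unitary factors, so the bound
    grows linearly and not geometrically in [k]. *)
Lemma telescope_unitary (A B : 'M[C]_n.+1) k :
  A \is unitarymx -> B \is unitarymx ->
  sumnorm (A ^+ k - B ^+ k) <= k%:R * (c * sumnorm (A - B) * c).
Proof.
move=> hA hB; rewrite -[A ^+ k - _]mul1mx.
(* Generalizing over a unitary left factor lets the induction absorb [A] without a new constant at
   each step. *)
elim: k (1%:M) (@unitary1 R n.+1) => [|k IH] X hX.
  by rewrite subrr mulmx0 sumnorm0 mul0r.
have -> : X *m (A ^+ k.+1 - B ^+ k.+1) =
    (X *m A) *m (A ^+ k - B ^+ k) + X *m (A - B) *m B ^+ k.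
  rewrite !exprS -[A * _]/(A *m _) -[B * _]/(B *m _) !mulmxBr mulmxBl !mulmxA.
  by rewrite addrA addrNK.
have hXA := mul_unitarymx hX hA; have hBk := unitaryX k hB.
have h1 : sumnorm (X *m (A - B) *m B ^+ k) <= c * sumnorm (A - B) * c.
  exact: sumnorm_sandwich hX hBk.
rewrite mulrS mulrDl mul1r [leRHS]addrC.
exact: le_trans (sumnormD _ _) (lerD (IH _ hXA) h1).
Qed.

End Expmx.

(** * Tangent directions of a closed semigroup of unitaries *)

HB.lock Definition step {R : realType} {n : nat} (K : 'M[R[i]]_n.+1) (h : R) :
  'M[R[i]]_n.+1 := 1 - 'i%C *: (h%:C *: K).
Canonical step_unlockable := Unlockable step.unlock.

Section ClosedSemigroup.
Context {R : realType} {n : nat}.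
Local Notation C := R[i].
Implicit Types (K L U : 'M[C]_n.+1) (G : 'M[C]_n.+1 -> Prop).
Import Normc.

Definition closed_semigroup G :=
  [/\ G 1, forall g h, G g -> G h -> G (g *m h), forall g, G g -> g \is unitarymx &
   forall U, U \is unitarymx ->
     (forall e : R, 0 < e -> exists2 g, G g & sumnorm (U - g) < e) -> G U].

Let c : R := (n.+1 * n.+1)%:R.
Let c0 : 0 < c. Proof. by rewrite ltr0n. Qed.

Lemma near_mul_le (q e : R) : 0 < e -> \forall h \near 0^'+, h * q <= e.
Proof.
move=> e0; near=> h.
have h0 : 0 < h by [].
apply: (@le_trans _ _ (h * (`|q| + 1))).
  by rewrite ler_wpM2l ?(ltW h0) // (le_trans (ler_norm q)) // lerDl.
have q1 : 0 < `|q| + 1 by rewrite ltr_wpDl.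
rewrite -ler_pdivlMr //; near: h.
by apply: nbhs_right_le; rewrite divr_gt0.
Unshelve. all: by end_near.
Qed.

Lemma near_right_nat (P : R -> Prop) :
  (\forall h \near 0^'+, P h) -> exists k : nat, P (k.+1%:R^-1).
Proof.
rewrite /at_right /within /= => /nbhs_ballP[d /= d0 hd].
have [k _ hk] := near_infty_natSinv_lt (PosNum d0).
exists k; apply: hd; last by rewrite invr_gt0 ltr0n.
rewrite /ball /= sub0r normrN ger0_norm ?invr_ge0 //.
exact: (hk k (leqnn k)).
Qed.

(* [G] contains [1 - ihK + o(h)] as [h] tends to [0+]. *)
Definition tangent G K := K \is hermsymmx /\
  forall e : R, 0 < e -> \forall h \near 0^'+,
    exists2 g, G g & sumnorm (g - step K h) <= e * h.

Lemma stepE K h : step K h = 1 - 'i%C *: (h%:C *: K).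
Proof. by rewrite unlock. Qed.

Lemma sumnorm_iZ (h : R) K : 0 < h -> sumnorm ('i%C *: (h%:C *: K)) = h * sumnorm K.
Proof. by move=> h0; rewrite !sumnormZ normci mul1r normc_real gtr0_norm. Qed.

Lemma tangent0 G : closed_semigroup G -> tangent G 0.
Proof.
move=> [G1 _ _ _]; split; first by apply/hermitian_trC; rewrite linear0 map_mx0.
move=> e e0; near=> h; exists 1 => //.
by rewrite stepE !scaler0 subr0 subrr sumnorm0 mulr_ge0 ?ltW.
Unshelve. all: by end_near.
Qed.

Lemma tangentZ G K (a : R) : 0 < a -> tangent G K -> tangent G (a%:C *: K).
Proof.
move=> a0 [hK tK]; split; first exact: hermZ.
move=> e e0; have ea0 : 0 < e / a by rewrite divr_gt0.
have /= := tK _ ea0; rewrite /at_right /within /= => /nbhs_ballP[d /= d0 hd].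
apply/nbhs_ballP; exists (d / a); first by rewrite /= divr_gt0.
move=> h /=; rewrite /ball /= sub0r normrN => hda h0.
have [] := hd (h * a).
- rewrite /ball /= sub0r normrN normrM (gtr0_norm a0).
  by rewrite -ltr_pdivlMr.
- by rewrite mulr_gt0.
move=> g Gg hg; exists g => //.
have -> : step (a%:C *: K) h = step K (h * a).
  rewrite [LHS]stepE [RHS]stepE rmorphM -(scalerA _ _ K); reflexivity.
apply: le_trans hg _.
by rewrite mulrCA mulfVK ?gt_eqF // mulrC.
Qed.

Lemma tangentD G K L : closed_semigroup G ->
  tangent G K -> tangent G L -> tangent G (K + L).
Proof.
move=> [_ GM Gu _] [hK tK] [hL tL]; split; first exact: hermD.
move=> e e0.
(* [D] collects the coefficients of the error [r]: [c] from the unitary [g'], [1] from the second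
   approximation, [sumnorm K] from the cross term when [h <= 1]. The other half of [e] covers
   [a *m b], quadratic in [h]. *)
set D := c + 1 + sumnorm K.
have D0 : 0 < D by rewrite /D; have := sumnorm_ge0 K; have := c0; lra.
have e1 : 0 < e / 2 / D by rewrite !divr_gt0.
near=> h.
have h0 : 0 < h by [].
have h1 : h <= 1 by near: h; exact: nbhs_right_le.
have hq : h * (sumnorm K * sumnorm L) <= e / 2.
  by near: h; apply: near_mul_le; rewrite divr_gt0.
have Eg : exists2 g, G g & sumnorm (g - step K h) <= e / 2 / D * h.
  by near: h; exact: tK.
have Eg' : exists2 g, G g & sumnorm (g - step L h) <= e / 2 / D * h.
  by near: h; exact: tL.
case: Eg Eg' => [g Gg hg] [g' Gg' hg'].
exists (g *m g'); first exact: GM.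
rewrite !stepE in hg hg' *.
set a := 'i%C *: (h%:C *: K) in hg *; set b := 'i%C *: (h%:C *: L) in hg' *.
have -> : 'i%C *: (h%:C *: (K + L)) = a + b by rewrite !scalerDr.
have -> : g *m g' - (1 - (a + b)) =
    (g - (1 - a)) *m g' + (g' - (1 - b)) - a *m (g' - (1 - b)) + a *m b.
  rewrite mulmxBr mulmxBl mulmxBl mulmxBr mulmx1 mul1mx.
  by apply/matrixP => i j; rewrite !mxE; ring.
have na : sumnorm a = h * sumnorm K by exact: sumnorm_iZ.
have nb : sumnorm b = h * sumnorm L by exact: sumnorm_iZ.
set r := e / 2 / D * h in hg hg'.
have r0 : 0 <= r by rewrite mulr_ge0 // ltW.
apply: le_trans (sumnormD _ _) _; apply: le_trans (lerD (sumnormD _ _) (sumnormM _ _)) _.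
rewrite sumnormN.
have b1 : sumnorm ((g - (1 - a)) *m g' + (g' - (1 - b))) <= r * c + r.
  apply: le_trans (sumnormD _ _) (lerD _ hg').
  exact: le_trans (sumnormM_unitaryr _ (Gu _ Gg')) (ler_wpM2r (ltW c0) hg).
have b2 : sumnorm (a *m (g' - (1 - b))) <= sumnorm K * r.
  have na' : sumnorm a <= sumnorm K by rewrite na ler_piMl ?sumnorm_ge0.
  apply: le_trans (sumnormM _ _) _.
  exact: ler_pM (sumnorm_ge0 _) (sumnorm_ge0 _) na' hg'.
have b3 : sumnorm a * sumnorm b <= e / 2 * h.
  rewrite na nb (_ : _ * _ = h * (sumnorm K * sumnorm L) * h); last by ring.
  by rewrite ler_wpM2r // ltW.
have b4 : r * D = e / 2 * h.
  by rewrite /r mulrAC mulfVK // gt_eqF.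
have -> : e * h = r * D + e / 2 * h by rewrite b4; field.
apply: lerD b3; rewrite (_ : r * D = r * c + r + sumnorm K * r); last by rewrite /D; ring.
exact: lerD b1 b2.
Unshelve. all: by end_near.
Qed.

(** Replacing [K] by [L] changes the step by [h] times their distance, which the tolerance [e * h]
    absorbs. *)
Lemma tangent_limit G K : K \is hermsymmx ->
  (forall e : R, 0 < e -> exists2 L, tangent G L & sumnorm (K - L) <= e) -> tangent G K.
Proof.
move=> hK hl; split => // e e0.
have e2 : 0 < e / 2 by rewrite divr_gt0.
have [L [_ tL] KL] := hl _ e2; near=> h.
have h0 : 0 < h by [].
have [g Gg hg] : exists2 g, G g &
    sumnorm (g - step L h) <= e / 2 * h.
  by near: h; exact: tL.
exists g => //.
have -> : g - step K h = (g - step L h) + 'i%C *: (h%:C *: (K - L)).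
  by rewrite !stepE; apply/matrixP => i j; rewrite !mxE; ring.
apply: le_trans (sumnormD _ _) _; rewrite sumnorm_iZ //.
have -> : e * h = e / 2 * h + h * (e / 2) by field.
exact: lerD hg (ler_wpM2l (ltW h0) KL).
Unshelve. all: by end_near.
Qed.

Lemma tangent_conj G K U : closed_semigroup G -> G U -> G (U^t*) ->
  tangent G K -> tangent G (U *m K *m U^t*).
Proof.
move=> [_ GM Gu _] GU GU' [hK tK]; split; first exact: herm_conj.
move=> e e0; have ec : 0 < e / c / c by rewrite !divr_gt0.
near=> h; have [g Gg hg] : exists2 g, G g &
    sumnorm (g - step K h) <= e / c / c * h.
  by near: h; exact: tK.
exists (U *m g *m U^t*); first exact: GM (GM _ _ GU Gg) GU'.
have -> : U *m g *m U^t* - step (U *m K *m U^t*) h =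
   U *m (g - step K h) *m U^t*.
  rewrite !stepE !mulmxBr !mulmxBl mulmx1 (unitarymxP (Gu _ GU)).
  by rewrite -!scalemxAr -!scalemxAl.
apply: le_trans (sumnorm_sandwich _ (Gu _ GU) (Gu _ GU')) _.
apply: (@le_trans _ _ (c * (e / c / c * h) * c)).
  apply: ler_wpM2r; first exact: ltW.
  by apply: ler_wpM2l; [exact: ltW | exact: hg].
rewrite le_eqVlt; apply/orP; left; apply/eqP; field.
by rewrite gt_eqF.
Unshelve. all: by end_near.
Qed.

Lemma evol_tangent G K : K \is hermsymmx ->
  (forall h : R, 0 < h -> G (evol (h%:C *: K))) -> tangent G K.
Proof.
move=> hK hG; split => // e e0; have [M M0 hM] := @evol_taylor R n.
near=> h; have h0 : 0 < h by [].
exists (evol (h%:C *: K)); first exact: hG.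
rewrite stepE; apply: le_trans (hM _ (hermZ h hK)) _.
rewrite sumnormZ normc_real gtr0_norm //.
have hq : h * (M * sumnorm K ^+ 2) <= e by near: h; exact: near_mul_le.
rewrite (_ : M * _ = h * (M * sumnorm K ^+ 2) * h); last by ring.
by rewrite ler_wpM2r // ltW.
Unshelve. all: by end_near.
Qed.

(* [g^k] tends to [exp(-iK)] when [g = 1 - iK/k + o(1/k)]. *)
Lemma tangent_evol G K : closed_semigroup G -> tangent G K -> G (evol K).
Proof.
move=> [G1 GM Gu Gc] [hK tK]; apply: Gc; first exact: evol_unitary.
move=> e e0; have [M M0 hM] := @evol_taylor R n.
(* The divisions by [c] undo the constants of [telescope_unitary]; the Taylor error and the tangent
   error use one third of [e] each. *)
have e3 : 0 < e / 3 / c / c by rewrite !divr_gt0.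
have [k [hk [g Gg hg]]] : exists k : nat,
    (k.+1%:R^-1 * (M * sumnorm K ^+ 2) <= e / 3 / c / c) /\
    exists2 g, G g &
    sumnorm (g - step K (k.+1%:R^-1)) <= e / 3 / c / c * k.+1%:R^-1.
  apply: (@near_right_nat (fun h => h * (M * sumnorm K ^+ 2) <= e / 3 / c / c /\
     exists2 g, G g & sumnorm (g - step K h) <= e / 3 / c / c * h)).
  near=> h; split; first by near: h; exact: near_mul_le.
  by near: h; exact: tK.
exists (g ^+ k.+1).
  elim: (k.+1) => [|j IH]; first by rewrite expr0.
  by rewrite exprS; exact: GM.
set h : R := k.+1%:R^-1 in hk hg.
have h0 : 0 < h by rewrite invr_gt0 ltr0n.
rewrite (evol_root k hK) -/h.
apply: le_lt_trans (telescope_unitary _ (evol_unitary (hermZ _ hK)) (Gu _ Gg)) _.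
have d1 : sumnorm (evol (h%:C *: K) - g) <= 2 * (e / 3 / c / c) * h.
  have -> : evol (h%:C *: K) - g = (evol (h%:C *: K) - step K h)
     - (g - step K h).
    by apply/matrixP => i j; rewrite !mxE; ring.
  have t1 : sumnorm (evol (h%:C *: K) - step K h) <= e / 3 / c / c * h.
    rewrite stepE; apply: le_trans (hM _ (hermZ h hK)) _.
    rewrite sumnormZ normc_real gtr0_norm //.
    rewrite (_ : M * _ = h * (M * sumnorm K ^+ 2) * h); last by ring.
    by apply: ler_wpM2r; [exact: ltW | exact: hk].
  apply: le_trans (sumnormD _ _) _; rewrite sumnormN.
  rewrite (_ : 2 * _ * h = e / 3 / c / c * h + e / 3 / c / c * h); last by ring.
  exact: lerD t1 hg.
apply: (@le_lt_trans _ _ (k.+1%:R * (c * (2 * (e / 3 / c / c) * h) * c))).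
  apply: ler_wpM2l; first exact: ler0n.
  apply: ler_wpM2r; first exact: ltW.
  by apply: ler_wpM2l; [exact: ltW | exact: d1].
have -> : k.+1%:R * (c * (2 * (e / 3 / c / c) * h) * c) = 2 * e / 3.
  by rewrite /h; field; rewrite gt_eqF //= nat1r pnatr_eq0.
lra.
Unshelve. all: by end_near.
Qed.

End ClosedSemigroup.

(** * Inverses and brackets in the closure *)

Section Recurrence.
Context {R : realType} {n : nat}.
Local Notation C := R[i].
Implicit Types (K L U : 'M[C]_n.+1) (G : 'M[C]_n.+1 -> Prop).
Import Normc.

Lemma normc_le_ReIm (z : C) : normc z <= `|complex.Re z| + `|complex.Im z|.
Proof.
rewrite {1}[z]complexE; apply: le_trans (normcD _ _) _.
by rewrite normcM normci mul1r !normc_real.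
Qed.

Lemma abs_ReIm_le (z : C) : `|complex.Re z| <= normc z /\ `|complex.Im z| <= normc z.
Proof.
case: z => a b /=; rewrite -!sqrtr_sqr.
by split; apply: ler_wsqrtr; rewrite ?lerDl ?lerDr sqr_ge0.
Qed.

Lemma box_close (N : nat) (x y : R) : (0 < N)%N -> -1 <= x -> -1 <= y ->
  Num.truncn ((x + 1) * N%:R) = Num.truncn ((y + 1) * N%:R) ->
  `|x - y| <= N%:R^-1.
Proof.
move=> N0 x1 y1 e.
have N0' : 0 < N%:R :> R by rewrite ltr0n.
have hx : 0 <= (x + 1) * N%:R by rewrite mulr_ge0 // -lerBlDr sub0r.
have hy : 0 <= (y + 1) * N%:R by rewrite mulr_ge0 // -lerBlDr sub0r.
have /andP[a1 a2] := truncn_itv hx; have /andP[b1 b2] := truncn_itv hy.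
rewrite e -natr1 in a1 a2; rewrite -natr1 in b2.
rewrite -[leRHS]mul1r ler_pdivlMr // -[X in _ * X](gtr0_norm N0') -normrM ler_norml.
by apply/andP; split; nra.
Qed.

(* Pigeonhole: the entries of the powers of [U] lie in finitely many small boxes. *)
Lemma unitary_recurrence U (e : R) : U \is unitarymx -> 0 < e ->
  exists p q : nat, (p < q)%N /\ sumnorm (U ^+ p - U ^+ q) < e.
Proof.
move=> hU e0.
set c : R := (n.+1 * n.+1)%:R.
(* Each of the [c] entries will contribute at most [2 / N]: [1 / N] for the real part and [1 / N]
   for the imaginary part. *)
have [N hN] : exists N : nat, c * 2 / e < N%:R.
  by exists (Num.truncn (c * 2 / e)).+1; exact: truncnS_gt.
have N0 : (0 < N)%N.
  by rewrite -(@ltr0n R) (le_lt_trans _ hN) // divr_ge0 ?mulr_ge0 ?ltW.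
(* Boxes of width [1 / N] on [[-1, 1]]. The index [2 * N] occurs only at the right endpoint, and
   [inord] never takes its default value on this interval. *)
pose box (x : R) : 'I_(2 * N).+1 := inord (Num.truncn ((x + 1) * N%:R)).
have boxP (x y : R) : `|x| <= 1 -> `|y| <= 1 -> box x = box y -> `|x - y| <= N%:R^-1.
  have bnd (z : R) : `|z| <= 1 -> (Num.truncn ((z + 1) * N%:R) < (2 * N).+1)%N.
    rewrite ler_norml => /andP[z1 z2]; rewrite ltnS -(ler_nat R).
    have hz : 0 <= (z + 1) * N%:R by rewrite mulr_ge0 // -lerBlDr sub0r.
    have /andP[h1 _] := truncn_itv hz; apply: le_trans h1 _.
    by rewrite natrM ler_wpM2r // -lerBrDr; lra.
  move=> hx hy /(congr1 val); rewrite /= !inordK ?bnd //.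
  by apply: box_close => //; move: hx hy; rewrite !ler_norml => /andP[? _] /andP[].
pose f (k : nat) : {ffun 'I_n.+1 * 'I_n.+1 -> 'I_(2 * N).+1 * 'I_(2 * N).+1} :=
  [ffun ij => (box (complex.Re ((U ^+ k) ij.1 ij.2)), box (complex.Im ((U ^+ k) ij.1 ij.2)))].
have [p [q [pq fpq]]] : exists p q : nat, (p < q)%N /\ f p = f q.
  pose T := {ffun 'I_n.+1 * 'I_n.+1 -> 'I_(2 * N).+1 * 'I_(2 * N).+1}.
  pose g (k : 'I_#|T|.+1) : T := f k.
  have : ~~ injectiveb g.
    apply/negP => /injectiveP /leq_card; rewrite card_ord.
    by rewrite ltnn.
  move=> /injectivePn [x [y xy gxy]].
  case: (ltngtP x y) => [lt|lt|/val_inj eq].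
  - by exists x, y.
  - by exists y, x.
  - by rewrite eq eqxx in xy.
exists p, q; split => //.
have ent (k : nat) i j : `|complex.Re ((U ^+ k) i j)| <= 1 /\ `|complex.Im ((U ^+ k) i j)| <= 1.
  have [h1 h2] := abs_ReIm_le ((U ^+ k) i j).
  have h3 := unitary_normc_le1 i j (unitaryX k hU).
  by split; [exact: le_trans h1 h3 | exact: le_trans h2 h3].
apply: (@le_lt_trans _ _ (\sum_(i < n.+1) \sum_(j < n.+1) 2 * N%:R^-1)).
  apply: ler_sum => i _; apply: ler_sum => j _.
  move/ffunP: fpq => /(_ (i, j)); rewrite !ffunE /= => -[e1 e2].
  have [r1 i1] := ent p i j; have [r2 i2] := ent q i j.
  apply: le_trans (normc_le_ReIm _) _; rewrite mulr_natl mulr2n.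
  have -> : (U ^+ p - U ^+ q) i j = (U ^+ p) i j - (U ^+ q) i j by rewrite !mxE.
  move: (boxP _ _ r1 r2 e1) (boxP _ _ i1 i2 e2).
  case: ((U ^+ p) i j) => a b; case: ((U ^+ q) i j) => a' b' /=.
  exact: lerD.
rewrite sumr_const card_ord sumr_const card_ord -mulrnA -[ltLHS]mulr_natl mulrA -/c.
by rewrite ltr_pdivrMr ?ltr0n // -ltr_pdivrMl // mulrC.
Qed.

(** If [U ^+ p] is close to [U ^+ q] with [p < q], multiplication by the inverse of [U ^+ p.+1]
    shows that [U ^+ (q - p.+1)] is close to the inverse of [U]. The exponent may be [0], where
    [G 1] is used. *)
Lemma closed_semigroup_trC G U : closed_semigroup G -> G U -> G (U^t*).
Proof.
move=> [G1 GM Gu Gc] GU; have hU := Gu _ GU.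
apply: Gc; first by rewrite trmxC_unitary.
move=> e e0; set c : R := (n.+1 * n.+1)%:R.
have c0 : 0 < c by rewrite ltr0n.
have [p [q [pq hpq]]] := unitary_recurrence hU (divr_gt0 e0 c0).
exists (U ^+ (q - p.+1)).
  elim: (q - p.+1)%N => [|k IH]; first by rewrite expr0.
  by rewrite exprS; exact: GM.
have hV : (U ^+ p.+1)^t* \is unitarymx by rewrite trmxC_unitary; exact: unitaryX.
have VU : (U ^+ p.+1)^t* *m U ^+ p.+1 = 1%:M := unitarymx_trCmul (unitaryX _ hU).
have -> : U^t* - U ^+ (q - p.+1) = (U ^+ p.+1)^t* *m (U ^+ p - U ^+ q).
  rewrite mulmxBr; congr (_ - _); last first.
    by rewrite -[in RHS](subnKC pq) exprD [_ * _]/(_ *m _) mulmxA VU mul1mx.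
  rewrite exprSr [_ * _]/(_ *m _) trmx_mul map_mxM -mulmxA.
  by rewrite (unitarymx_trCmul (unitaryX p hU)) mulmx1.
apply: le_lt_trans (sumnormM_unitaryl _ hV) _.
by rewrite mulrC -ltr_pdivlMr.
Qed.

End Recurrence.

(** The remainder is written with the perturbed factors [A + r] and [B + s], which will be unitary
    and hence of bounded norm. *)
Lemma mulmx_perturb (F : comNzRingType) (n : nat) (A B L r s : 'M[F]_n) :
  (A + r) *m L *m (B + s) =
  A *m L *m B + (r *m L *m (B + s) + (A + r) *m L *m s - r *m L *m s).
Proof.
rewrite !mulmxDl !mulmxDr.
move: (A *m L *m B) (A *m L *m s) (r *m L *m B) (r *m L *m s) => a b c d.
by apply/matrixP => i j; rewrite !mxE; ring.
Qed.

Lemma mulmx_cayley (F : comNzRingType) (n : nat) (L X : 'M[F]_n) :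
  (1%:M - X) *m L *m (1%:M + X) = L - (X *m L - L *m X) - X *m L *m X.
Proof.
rewrite !mulmxBl !mulmxDr !mul1mx !mulmx1.
move: (X *m L *m X) (X *m L) (L *m X) => a b c.
by apply/matrixP => i j; rewrite !mxE; ring.
Qed.

Section Lie.
Context {R : realType} {n : nat}.
Local Notation C := R[i].
Implicit Types (K L U : 'M[C]_n.+1) (G : 'M[C]_n.+1 -> Prop).
Import Normc.

(** Tangent directions form only a convex cone; those with a tangent negative form a real vector
    space. *)
Definition lie G K := tangent G K /\ tangent G (- K).

Lemma lieD G K L : closed_semigroup G -> lie G K -> lie G L -> lie G (K + L).
Proof.
move=> hG [k1 k2] [l1 l2]; split; first exact: tangentD.
by rewrite opprD; exact: tangentD.
Qed.

Lemma lieN G K : lie G K -> lie G (- K).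
Proof. by case=> k1 k2; split => //; rewrite opprK. Qed.

Lemma lieZ G K (a : R) : closed_semigroup G -> lie G K -> lie G (a%:C *: K).
Proof.
move=> hG [k1 k2]; have [a0|a0|->] := ltgtP a 0.
- rewrite -[a]opprK rmorphN scaleNr; have a0' : 0 < - a by rewrite oppr_gt0.
  split; first by rewrite -scalerN; exact: tangentZ.
  by rewrite opprK; exact: tangentZ.
- by split; [|rewrite -scalerN]; exact: tangentZ.
- by rewrite scale0r; split; rewrite ?oppr0; exact: tangent0.
Qed.

Lemma lie_herm G K : lie G K -> K \is hermsymmx.
Proof. by case=> -[]. Qed.

Lemma lie_limit G K : K \is hermsymmx ->
  (forall e : R, 0 < e -> exists2 L, lie G L & sumnorm (K - L) <= e) -> lie G K.
Proof.
move=> hK h; split; apply: tangent_limit.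
- exact: hK.
- by move=> e /h[L [l _] KL]; exists L.
- exact: hermN.
- move=> e /h[L [_ l] KL]; exists (- L) => //.
  by rewrite -opprD sumnormN.
Qed.

Lemma lie_conj G K U : closed_semigroup G -> G U -> G (U^t*) ->
  lie G K -> lie G (U *m K *m U^t*).
Proof.
move=> hG GU GU' [k1 k2]; split; first exact: tangent_conj.
by rewrite -mulNmx -mulmxN; exact: tangent_conj.
Qed.

Lemma lie_evol G K : closed_semigroup G -> lie G K -> G (evol K) /\ G ((evol K)^t*).
Proof.
move=> hG hK; split; first exact: tangent_evol hG hK.1.
by rewrite (evol_trC (lie_herm hK)); exact: tangent_evol hG hK.2.
Qed.

Let c : R := (n.+1 * n.+1)%:R.

(** With [X = ihK], [E = 1 - X + r] where [r] is of order [h^2]. As [X] is anti-Hermitian, the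
    adjoint of [E] is [1 + X] plus that of [r], and the linear part of the conjugate of [L] is minus
    the commutator of [X] and [L]. *)
Lemma evol_conj_taylor K L : K \is hermsymmx -> exists2 Q : R, 0 <= Q &
  forall h : R, 0 < h -> h <= 1 ->
  sumnorm (evol (h%:C *: K) *m L *m (evol (h%:C *: K))^t* -
    (L - h%:C *: ('i%C *: (K *m L - L *m K)))) <= h * Q * h.
Proof.
move=> hK; have [M M0 hM] := @evol_taylor R n.
set k := sumnorm K; set l := sumnorm L.
have k0 : 0 <= k := sumnorm_ge0 K; have l0 : 0 <= l := sumnorm_ge0 L.
have c0 : 0 <= c by [].
set m := M * k ^+ 2; have m0 : 0 <= m by rewrite mulr_ge0 ?exprn_ge0.
(* The first summand bounds the two terms with one [r] and one [E], the second the term with two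
   [r], the third [X L X]; [h <= 1] reduces the [h^4] of the second to [h^2]. *)
exists (2 * (m * l * c) + m * l * m + k * l * k).
  by rewrite !addr_ge0 ?mulr_ge0.
move=> h h0 h1; set E := evol _.
have hE : E \is unitarymx by exact: evol_unitary (hermZ h hK).
have hE' : E^t* \is unitarymx by rewrite trmxC_unitary.
pose X := 'i%C *: (h%:C *: K); pose r := E - (1 - X).
have Xt : X^t* = - X.
  apply/matrixP => i j; have /matrixP /(_ i j) := hermitian_trC _ hK; rewrite !mxE => e.
  rewrite rmorphM rmorphM /= e (_ : (('i%C : C)^*)%R = - 'i%C); last by rewrite complexiE conjCi.
  by rewrite (_ : ((h%:C : C)^*)%R = h%:C) ?mulNr //; exact: conjc_real.
have nX : sumnorm X = h * k by exact: sumnorm_iZ.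
have nr : sumnorm r <= m * h * h.
  have := hM _ (hermZ h hK); rewrite sumnormZ normc_real gtr0_norm //.
  by rewrite (_ : M * _ = m * h * h) //; rewrite /m /k; ring.
have -> : E *m L *m E^t* - (L - h%:C *: ('i%C *: (K *m L - L *m K))) =
    r *m L *m E^t* + E *m L *m r^t* - r *m L *m r^t* - X *m L *m X.
  have eE : E = 1 - X + r by rewrite /r addrC subrK.
  have eE' : E^t* = 1 + X + r^t*.
    by rewrite {1}eE !linearD /= !map_mxD linearN map_mxN /= Xt opprK trmx1 map_mx1.
  have eX : h%:C *: ('i%C *: (K *m L - L *m K)) = X *m L - L *m X.
    rewrite /X -!scalemxAl -!scalemxAr -!scalerBr !scalerA; congr (_ *: _).
    exact: mulrC.
  rewrite eX {1}eE {1}eE' mulmx_perturb -eE -eE' mulmx_cayley.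
  move: (r *m L *m E^t*) (E *m L *m r^t*) (r *m L *m r^t*) (X *m L *m X) (X *m L - L *m X).
  by move=> x1 x2 x3 x4 x5; apply/matrixP => i j; rewrite !mxE; ring.
apply: le_trans (sumnormD _ _) _; rewrite sumnormN.
apply: le_trans (lerD (sumnormD _ _) (lexx _)) _; rewrite sumnormN.
apply: le_trans (lerD (lerD (sumnormD _ _) (lexx _)) (lexx _)) _.
have n1 : sumnorm (r *m L *m E^t*) <= m * h * h * l * c.
  apply: le_trans (sumnormM_unitaryr _ hE') _.
  apply: ler_wpM2r; first exact: c0.
  apply: le_trans (sumnormM _ _) _.
  by apply: ler_wpM2r; [exact: l0|exact: nr].
have nr' : sumnorm (r^t*) <= m * h * h by rewrite sumnorm_trC; exact: nr.
have n2 : sumnorm (E *m L *m r^t*) <= c * l * (m * h * h).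
  apply: le_trans (sumnormM _ _) _.
  apply: ler_pM (sumnorm_ge0 _) (sumnorm_ge0 _) _ nr'.
  exact: sumnormM_unitaryl.
have n3 : sumnorm (r *m L *m r^t*) <= m * h * h * l * (m * h * h).
  apply: le_trans (sumnormM _ _) _.
  apply: ler_pM (sumnorm_ge0 _) (sumnorm_ge0 _) _ nr'.
  apply: le_trans (sumnormM _ _) _.
  by apply: ler_wpM2r; [exact: l0|exact: nr].
have n4 : sumnorm (X *m L *m X) <= h * k * l * (h * k).
  apply: le_trans (sumnormM _ _) _; rewrite nX.
  apply: ler_wpM2r; first by rewrite mulr_ge0 // ltW.
  by apply: le_trans (sumnormM _ _) _; rewrite nX.
apply: le_trans (lerD (lerD (lerD n1 n2) n3) n4) _.
have h01 : h * h <= 1 by rewrite mulr_ile1 // ltW.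
have -> : h * (2 * (m * l * c) + m * l * m + k * l * k) * h =
  m * h * h * l * c + c * l * (m * h * h) + m * l * m * (h * h) * 1 + h * k * l * (h * k) by ring.
rewrite lerD2r lerD2l (_ : m * h * h * l * (m * h * h) = m * l * m * (h * h) * (h * h)); last by ring.
apply: ler_wpM2l h01.
by rewrite !mulr_ge0 // ltW.
Qed.

(* [i [K, L]] is minus the derivative at [0] of [exp(-ihK) L exp(ihK)]. *)
Lemma lie_bracket G K L : closed_semigroup G -> lie G K -> lie G L ->
  lie G ('i%C *: (K *m L - L *m K)).
Proof.
move=> hG hK hL; have hhK := lie_herm hK; have hhL := lie_herm hL.
rewrite -[_ *: _]opprK; apply: lieN; apply: lie_limit.
  apply/hermitian_trC/matrixP => i j.
  have hK' x y : ((K y x)^*)%R = K x y by have /matrixP/(_ x y) := hermitian_trC _ hhK; rewrite !mxE.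
  have hL' x y : ((L y x)^*)%R = L x y by have /matrixP/(_ x y) := hermitian_trC _ hhL; rewrite !mxE.
  rewrite !mxE rmorphN rmorphM /= (_ : (('i%C : C)^*)%R = - 'i%C); last by rewrite complexiE conjCi.
  rewrite rmorphB !rmorph_sum /= mulNr; congr (- _); rewrite -mulrN opprB; congr (_ * (_ - _)).
    by apply: eq_bigr => a _; rewrite rmorphM /= hK' hL' mulrC.
  by apply: eq_bigr => a _; rewrite rmorphM /= hK' hL' mulrC.
move=> e e0; have [Q Q0 hQ] := evol_conj_taylor L hhK.
have [h [h0 h1 hq]] : exists h : R, [/\ 0 < h, h <= 1 & h * Q <= e].
  have [k [h1 h2]] : exists k : nat, (k.+1%:R^-1 : R) <= 1 /\ k.+1%:R^-1 * Q <= e.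
    apply: (@near_right_nat _ (fun h => h <= 1 /\ h * Q <= e)).
    near=> h; split; first by near: h; exact: nbhs_right_le.
    by near: h; exact: near_mul_le.
  by exists k.+1%:R^-1; split => //; rewrite invr_gt0 ltr0n.
set E := evol (h%:C *: K) in hQ.
have [GE GE'] := lie_evol hG (lieZ h hG hK).
(* The difference quotient at [0] is a real combination of [L] and a conjugate of [L], hence in the
   Lie algebra for each [h]. *)
exists ((h^-1)%:C *: (evol (h%:C *: K) *m L *m (evol (h%:C *: K))^t* - L)).
  exact: lieZ hG (lieD hG (lie_conj hG GE GE' hL) (lieN hL)).
move: (hQ _ h0 h1); set Y := _ *m _ *m _; set B := 'i%C *: _ => hY.
have -> : - B - (h^-1)%:C *: (Y - L) = - ((h^-1)%:C *: (Y - (L - h%:C *: B))).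
  have hB : (h^-1)%:C *: (h%:C *: B) = B.
    by rewrite scalerA -(rmorphM (real_complex R)) mulVf ?gt_eqF // scale1r.
  by rewrite [in RHS]opprB [in RHS]addrCA [in RHS]scalerDr hB opprD.
rewrite sumnormN sumnormZ normc_real gtr0_norm ?invr_gt0 //.
rewrite mulrC ler_pdivrMr //; apply: le_trans hY _.
by rewrite ler_wpM2r // ltW.
Unshelve. all: by end_near.
Qed.

End Lie.

(** * Universality as density of words *)

Section OperatorNorm.
Context {R : realType}.
Local Notation C := R[i].
Import Normc.

Lemma normc_le_l2norm n (v : 'cV[C]_n) k : normc (v k 0) <= l2norm v.
Proof.
rewrite -[leLHS](ger0_norm (normc_ge0 _)) -sqrtr_sqr; apply: ler_wsqrtr.
by rewrite (bigD1 k) //= lerDl; apply: sumr_ge0 => j _; exact: sqr_ge0.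
Qed.

Lemma l2norm_le_sum n (v : 'cV[C]_n) : l2norm v <= \sum_k normc (v k 0).
Proof.
have s0 : 0 <= \sum_k normc (v k 0) by apply: sumr_ge0 => j _; exact: normc_ge0.
rewrite -[leRHS](ger0_norm s0) -sqrtr_sqr; apply: ler_wsqrtr.
rewrite [leRHS]expr2 mulr_suml; apply: ler_sum => k _.
rewrite expr2; apply: ler_wpM2l; first exact: normc_ge0.
by rewrite (bigD1 k) //= lerDl; apply: sumr_ge0 => j _; exact: normc_ge0.
Qed.

Lemma l2norm_mul_le m (A : 'M[C]_m) (v : 'cV[C]_m) : l2norm v = 1 ->
  l2norm (A *m v) <= sumnorm A.
Proof.
move=> v1; apply: le_trans (l2norm_le_sum _) _; apply: ler_sum => i _.
rewrite mxE; apply: le_trans (normc_sum _ _ _) _; apply: ler_sum => j _.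
rewrite normcM ler_piMr ?normc_ge0 // -v1.
exact: normc_le_l2norm.
Qed.

Lemma l2norm_delta n (j : 'I_n) : l2norm (delta_mx j 0 : 'cV[C]_n) = 1.
Proof.
rewrite /l2norm (bigD1 j) //= big1 => [|k kj].
  by rewrite mxE !eqxx normc1 expr1n addr0 sqrtr1.
by rewrite mxE (negbTE kj) normc0 expr0n.
Qed.

Lemma opnorm_le_sumnorm n (A : 'M[C]_n.+1) : opnorm A <= sumnorm A.
Proof.
apply: ge_sup.
  by exists (l2norm (A *m delta_mx 0 0)), (delta_mx 0 0) => //; exact: l2norm_delta.
by move=> _ [v v1 <-]; exact: l2norm_mul_le.
Qed.

Lemma normc_le_opnorm n (A : 'M[C]_n.+1) i j : normc (A i j) <= opnorm A.
Proof.
apply: (@le_trans _ _ (l2norm (A *m delta_mx j 0))).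
  by have := normc_le_l2norm (A *m delta_mx j 0) i; rewrite -colE mxE.
apply: ub_le_sup.
  by exists (sumnorm A) => _ [v v1 <-]; exact: l2norm_mul_le.
by exists (delta_mx j 0) => //; exact: l2norm_delta.
Qed.

End OperatorNorm.

(** * Words in the two evolutions *)

Section Words.
Context {R : realType}.
Local Notation C := R[i].
Implicit Types (H U W : 'M[C]_4) (S : 'M[C]_4 -> Prop).
Import Normc.

Definition swapped H : 'M[C]_4 := swapgate R *m H *m swapgate R.

Definition letter H (p : bool * R) : 'M[C]_4 :=
  evol (p.2%:C *: (if p.1 then H else swapped H)).

Definition word H W := exists2 s : seq (bool * R),
  all (fun p => 0 < p.2) s & W = \prod_(p <- s) letter H p.

Lemma word1 H : word H 1.
Proof. by exists [::]; rewrite ?big_nil. Qed.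

Lemma wordM H V W : word H V -> word H W -> word H (V *m W).
Proof.
move=> [s hs ->] [t ht ->]; exists (s ++ t); first by rewrite all_cat hs.
by rewrite big_cat.
Qed.

Lemma word_letter H b (t : R) : 0 < t -> word H (letter H (b, t)).
Proof. by move=> t0; exists [:: (b, t)]; rewrite ?big_seq1 //= t0. Qed.

Lemma word_ind H S : S 1 -> (forall V W, S V -> S W -> S (V *m W)) ->
  (forall b t, S (letter H (b, t))) -> forall W, word H W -> S W.
Proof.
move=> S1 SM SL W [s _ ->]; elim: s => [|[b t] s IH]; first by rewrite big_nil.
by rewrite big_cons; exact: SM (SL b t) IH.
Qed.

(** Lists in place of indexed families make concatenation and induction on words available. *)
Lemma two_universalP H : two_universal H <->
  forall U (e : R), U \is unitarymx -> 0 < e ->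
  exists2 W, word H W & opnorm (U - W) < e.
Proof.
have evE t (K : 'M[C]_4) : expmx ((- 'i%C * t%:C) *: K) = evol (t%:C *: K).
  by rewrite [@evol]unlock scalerA.
split=> hu U e hU e0.
- have [l [Hs [ts [hHs hts hl]]]] := hu U e hU e0.
  exists (\prod_(k < l) expmx ((- 'i%C * (ts k)%:C) *: Hs k)) => //.
  have hb k : exists b : bool, Hs k = if b then H else swapped H.
    by case: (hHs k) => ->; [exists true | exists false].
  have [b hb'] := choice hb.
  exists [seq (b k, ts k) | k <- index_enum 'I_l].
    by apply/allP => p /mapP[k _ ->] /=.
  by rewrite big_map; apply: eq_bigr => k _; rewrite evE /letter /= -hb'.
- have [W [s hs ->] hl] := hu U e hU e0.
  pose p (k : 'I_(size s)) := nth (true, 0) s k.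
  exists (size s), (fun k => if (p k).1 then H else swapped H), (fun k => (p k).2).
  split.
  + by move=> k; case: ifP => _; [left | right].
  + by move=> k; move/all_nthP: hs; apply.
  + move: hl; rewrite (big_nth (true, 0)) big_mkord.
    under [X in opnorm (U - X) < e -> _]eq_bigr => k _ do rewrite /letter -evE.
    exact.
Qed.

Lemma swapgate_trC : (swapgate R)^t* = swapgate R.
Proof.
rewrite /swapgate /tperm_mx tr_perm_mx map_perm_mx; congr perm_mx.
exact: tpermV.
Qed.

Lemma swapgate_sqr : swapgate R *m swapgate R = 1%:M.
Proof. by rewrite /swapgate /tperm_mx -perm_mxM tperm2 perm_mx1. Qed.

Lemma swapgate_unitary : swapgate R \is unitarymx.
Proof. by apply/unitarymxP; rewrite swapgate_trC swapgate_sqr. Qed.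

Lemma swapped_herm H : H \is hermsymmx -> swapped H \is hermsymmx.
Proof.
move=> hH; rewrite /swapped -[X in _ *m X]swapgate_trC.
exact: herm_conj.
Qed.

(** Errors [1 / (k + 1)] turn density into entrywise convergence, through which polynomial
    identities on words pass to [U]. *)
Lemma approx_seq S U :
  (forall e : R, 0 < e -> exists2 W, S W & opnorm (U - W) < e) ->
  exists W : nat -> 'M[C]_4, (forall k, S (W k)) /\
   forall i j, (fun k => W k i j : (R[i] : numFieldType)) @ \oo --> (U i j : (R[i] : numFieldType)).
Proof.
move=> h.
have h' (k : nat) : exists W, S W /\ opnorm (U - W) < k.+1%:R^-1.
  by have [|W SW hW] := h k.+1%:R^-1; [rewrite invr_gt0 ltr0n | exists W].
have [W hW] := choice h'; exists W; split; first by move=> k; have [] := hW k.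
move=> i j; apply/cvgrPdist_lt => e e0.
have [e' e'0 ee] : exists2 e' : R, 0 < e' & e = e'%:C.
  exists (complex.Re e); last by rewrite (RRe_real (gtr0_real e0)).
  by move: e0; rewrite ltcE => /andP[].
have := near_infty_natSinv_lt (PosNum e'0); apply: filterS => k /= hk.
rewrite normcE_norm ee ltcR; apply: lt_trans hk.
apply: le_lt_trans (hW k).2.
by have := normc_le_opnorm (U - W k) i j; rewrite !mxE.
Qed.

End Words.

(** * Obstructions to universality *)

Section Obstructions.
Context {R : realType}.
Local Notation C := R[i].
Local Notation CN := (R[i] : numFieldType).
Implicit Types (H U W K : 'M[C]_4).
Import Normc.

Lemma evol_eigen K (v : 'cV[C]_4) a : K \is hermsymmx -> K *m v = a *: v ->
  exists z, evol K *m v = z *: v.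
Proof.
move=> /herm_spec[P [t [hP ->]]] hv.
(* In the eigenbasis, each nonzero coordinate of [v] belongs to an eigenvalue equal to [a], so [a]
   is real. *)
exists (phase (complex.Re a)); rewrite (evol_spec _ hP).
have PP : P^t* *m P = 1%:M := unitarymx_trCmul hP.
have hPv : diag_mx (map_mx (real_complex R) t) *m (P *m v) = a *: (P *m v).
  rewrite scalemxAr -hv specE [@udiag]unlock !mulmxA (unitarymxP hP) mul1mx.
  by [].
have e : diag_mx (phases t) *m (P *m v) = phase (complex.Re a) *: (P *m v).
  move: (P *m v) hPv => x hx.
  apply/matrixP => i j; move/matrixP: hx => /(_ i j).
  rewrite !mul_diag_mx !mxE phasesE.
  have [->|n0] := eqVneq (x i j) 0; first by rewrite !mulr0.
  by move/(mulIf n0) => <-.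
rewrite unlock -!mulmxA e -scalemxAr mulmxA PP mul1mx.
by [].
Qed.

(* Every word maps the shared eigenvector to a multiple of itself. *)
Lemma shared_not_universal H : H \is hermsymmx ->
  share_eigenvector H (swapgate R) -> ~ two_universal H.
Proof.
move=> hH [v [[v0 [a Hv]] [_ [b Tv]]]] /two_universalP hu.
(* The swap gate squares to the identity. Hence the two factors [b] cancel and [swapped H] has the
   same eigenvalue [a] at [v]. *)
have bb : b * b = 1.
  have := congr1 (mulmx (swapgate R)) Tv.
  rewrite mulmxA swapgate_sqr mul1mx -scalemxAr Tv scalerA => e.
  have /cV0Pn[k vk] := v0; apply: (mulIf vk); rewrite mul1r.
  by have /matrixP/(_ k 0) := e; rewrite mxE => h; symmetry; exact: h.
have Sv : swapped H *m v = a *: v.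
  rewrite /swapped -!mulmxA Tv -!scalemxAr Hv -!scalemxAr Tv.
  by rewrite !scalerA; congr (_ *: _); rewrite [LHS](_ : _ = a * (b * b)); [rewrite bb mulr1 | ring].
have wv W : word H W -> exists z, W *m v = z *: v.
  apply: (word_ind (S := fun W => exists z, W *m v = z *: v)).
  - by exists 1; rewrite mul1mx scale1r.
  - move=> V V' [z hz] [z' hz']; exists (z' * z).
    by rewrite -mulmxA hz' -scalemxAr hz scalerA.
  - move=> [] t.
      by apply: (@evol_eigen _ _ (t%:C * a)); [exact: hermZ | rewrite /= -scalemxAl Hv scalerA].
    apply: (@evol_eigen _ _ (t%:C * a)); first exact: hermZ (swapped_herm hH).
    by rewrite /= -scalemxAl Sv scalerA.
(* Collinearity of [U *m v] and [v] is expressed by vanishing two-by-two minors, a condition that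
   survives limits. *)
have Uv U i j : U \is unitarymx -> (U *m v) i 0 * v j 0 = (U *m v) j 0 * v i 0.
  move=> hU; have [W [hW cW]] := approx_seq (fun e e0 => hu U e hU e0).
  have cv k : (fun n => (W n *m v) k 0 : CN) @ \oo --> ((U *m v) k 0 : CN).
    rewrite mxE; have -> : (fun n => (W n *m v) k 0) = (fun n => \sum_l W n k l * v l 0).
      by apply/funext => n; rewrite mxE.
    apply: (@cvg_big CN _ +%R 0 xpredT _ _ _ _
      (fun l n => W n k l * v l 0) (fun l => U k l * v l 0)).
      exact: (@add_continuous CN).
    by move=> l _; apply: (@cvgMr_tmp CN); exact: cW.
  have h1 : (fun n => (W n *m v) i 0 * v j 0 : CN) @ \oo --> ((U *m v) i 0 * v j 0 : CN).
    by apply: (@cvgMr_tmp CN); exact: cv.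
  have h2 : (fun n => (W n *m v) j 0 * v i 0 : CN) @ \oo --> ((U *m v) j 0 * v i 0 : CN).
    by apply: (@cvgMr_tmp CN); exact: cv.
  have e : (fun n => (W n *m v) i 0 * v j 0) = (fun n => (W n *m v) j 0 * v i 0).
    apply/funext => n; have [z ->] := wv _ (hW n).
    by rewrite !mxE; ring.
  rewrite e in h1.
  exact: (cvg_unique (@norm_hausdorff _ CN) h1 h2).
have /cV0Pn[k vk] := v0.
(* Flipping the sign of coordinate [k] keeps the line of [v] only if the other coordinates vanish;
   exchanging [k] with another index then moves that line. *)
pose D : 'M[C]_4 := diag_mx (\row_j (if j == k then -1 else 1)).
have hD : D \is unitarymx.
  apply/unitarymxP; rewrite /D tr_diag_mx map_diag_mx mulmx_diag -diag_const_mx.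
  congr diag_mx; apply/rowP => j; rewrite !mxE.
  by case: ifP => _; rewrite ?rmorphN rmorph1 ?mulrNN mulr1.
have v_other j : j != k -> v j 0 = 0.
  move=> jk; have := Uv D k j hD; rewrite /D !mul_diag_mx !mxE eqxx (negbTE jk).
  rewrite mulN1r mul1r mulNr [v j 0 * _]mulrC => /eqP; rewrite -subr_eq0 -opprD oppr_eq0.
  by rewrite -mulr2n -mulr_natl !mulf_eq0 pnatr_eq0 (negbTE vk) /= => /eqP.
pose j : 'I_4 := if k == 0 then 1 else 0.
have jk : j != k by rewrite /j; have [->|] := eqVneq k 0; rewrite // eq_sym.
have hS : tperm_mx j k \is @unitarymx C 4 4.
  apply/unitarymxP; rewrite /tperm_mx tr_perm_mx map_perm_mx -perm_mxM mulgV.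
  exact: perm_mx1.
have := Uv _ j k hS; rewrite /tperm_mx -row_permE !mxE tpermL tpermR (v_other j jk) mulr0.
by move/eqP; rewrite mulf_eq0 orbb (negbTE vk).
Qed.

Lemma mxtrace_udiag (F : numClosedFieldType) n (P : 'M[F]_n.+1) d :
  P \is unitarymx -> \tr (udiag P d) = \sum_k d 0 k.
Proof.
move=> hP; rewrite unlock mxtrace_mulC mulmxA (unitarymxP hP) mul1mx.
exact: mxtrace_diag.
Qed.

Lemma det_udiag (F : numClosedFieldType) n (P : 'M[F]_n.+1) d :
  P \is unitarymx -> \det (udiag P d) = \prod_k d 0 k.
Proof.
move=> hP; rewrite unlock !det_mulmx mulrAC -det_mulmx (unitarymx_trCmul hP) det1 mul1r.
exact: det_diag.
Qed.

Lemma det_evol K : K \is hermsymmx -> \tr K = 0 -> \det (evol K) = 1.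
Proof.
move=> /herm_spec[P [t [hP ->]]] tr0.
rewrite (evol_spec _ hP) (det_udiag _ hP).
under eq_bigr => k _ do rewrite phasesE.
rewrite specE (mxtrace_udiag _ hP) in tr0.
have -> : \prod_k phase (t 0 k) = phase (\sum_k t 0 k).
  by elim/big_rec2: _ => [|k x y _ ->]; rewrite ?phase0 ?phaseD.
have -> : \sum_k t 0 k = 0.
  apply: complexI; rewrite -[RHS]tr0 rmorph_sum; apply: eq_bigr => k _.
  by rewrite mxE.
exact: phase0.
Qed.

(** Words have determinant one, which passes to limits, whereas the swap gate is the matrix of a
    transposition, of determinant [-1]. *)
Lemma traceless_not_universal H : H \is hermsymmx -> \tr H = 0 -> ~ two_universal H.
Proof.
move=> hH tr0 /two_universalP hu.
have wd W : word H W -> \det W = 1.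
  apply: (word_ind (S := fun W => \det W = 1)).
  - exact: det1.
  - by move=> V V' h h'; rewrite det_mulmx h h' mulr1.
  - move=> [] t; apply: det_evol.
    + exact: hermZ.
    + by rewrite mxtraceZ tr0 mulr0.
    + exact: hermZ (swapped_herm hH).
    + by rewrite mxtraceZ /swapped mxtrace_mulC mulmxA swapgate_sqr mul1mx tr0 mulr0.
have [W [hW cW]] := approx_seq (fun e e0 => hu _ e swapgate_unitary e0).
have cd : (fun n => \det (W n) : CN) @ \oo --> (\det (swapgate R) : CN).
  rewrite /determinant.
  apply: (@cvg_big CN _ +%R 0 xpredT _ _ _ _
      (fun (s : 'S_4) n => (-1) ^+ s * \prod_i W n i (s i))
      (fun s : 'S_4 => (-1) ^+ s * \prod_i swapgate R i (s i))).
    exact: (@add_continuous CN).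
  move=> s _; apply: (@cvgMl_tmp CN).
  apply: (@cvg_big CN _ *%R 1 xpredT _ _ _ _
      (fun i n => W n i (s i))
      (fun i => swapgate R i (s i))).
    exact: (@mul_continuous CN).
  by move=> i _; exact: cW.
have e : (fun n => \det (W n)) = (fun=> 1).
  by apply/funext => n; exact: wd (hW n).
rewrite e in cd.
have : \det (swapgate R) = 1.
  by apply: (cvg_unique (@norm_hausdorff _ CN) cd); exact: cvg_cst.
rewrite /swapgate /tperm_mx det_perm odd_tperm -val_eqE /= !inordK //= expr1.
by move=> /eqP; rewrite eq_sym -subr_eq0 opprK -mulr2n pnatr_eq0.
Qed.

Lemma tens1mx (F : comNzRingType) (m n : nat) : (1%:M : 'M[F]_m) *t (1%:M : 'M[F]_n) = 1%:M.
Proof.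
apply/matrixP => i j; case: (mxtens_indexP i) => i0 i1; case: (mxtens_indexP j) => j0 j1.
rewrite tensmxE !mxE (can_eq (@mxtens_indexK _ _)) xpair_eqE.
by case: (i0 == j0); case: (i1 == j1); rewrite ?mulr1 ?mulr0 ?mul0r.
Qed.

Lemma tens_trC (F : numClosedFieldType) (m n : nat) (A : 'M[F]_m) (B : 'M[F]_n) :
  (A *t B)^t* = A^t* *t B^t*.
Proof. by rewrite trmx_tens map_mxT. Qed.

Lemma tens_unitary (F : numClosedFieldType) (m n : nat) (A : 'M[F]_m) (B : 'M[F]_n) :
  A \is unitarymx -> B \is unitarymx -> (A *t B) \is unitarymx.
Proof.
move=> /unitarymxP hA /unitarymxP hB; apply/unitarymxP.
by rewrite tens_trC tensmx_mul hA hB tens1mx.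
Qed.

Lemma mxtens_index_eq4 (i0 i1 j0 j1 : 'I_2) :
  ((mxtens_index (i0, i1) : 'I_4) == mxtens_index (j0, j1)) = (i0 == j0) && (i1 == j1).
Proof. exact: (can_eq (@mxtens_indexK 2 2) (i0, i1) (j0, j1)). Qed.

(** Both summands are diagonal in the basis given by [P1 *t P2], so the eigenvalues add and their
    phases multiply. *)
Lemma evol_local (H1 H2 : 'M[C]_2) : H1 \is hermsymmx -> H2 \is hermsymmx ->
  exists A B : 'M[C]_2,
  @evol R 3 (H1 *t (1%:M : 'M[C]_2) + (1%:M : 'M[C]_2) *t H2) = A *t B.
Proof.
move=> /herm_spec[P1 [t1 [hP1 e1]]] /herm_spec[P2 [t2 [hP2 e2]]].
pose P : 'M[C]_4 := P1 *t P2.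
have hP : P \is unitarymx := tens_unitary hP1 hP2.
pose t : 'rV[R]_4 := \row_k (t1 0 (mxtens_unindex (k : 'I_(2 * 2))).1 +
                           t2 0 (mxtens_unindex (k : 'I_(2 * 2))).2).
exists (udiag P1 (phases t1)), (udiag P2 (phases t2)).
have -> : H1 *t (1%:M : 'M[C]_2) + (1%:M : 'M[C]_2) *t H2 = spec P t.
  rewrite specE e1 e2 !specE [@udiag]unlock /P [in RHS](tens_trC P1 P2).
  have -> : (diag_mx (map_mx (real_complex R) t) : 'M[C]_4) =
      diag_mx (map_mx (real_complex R) t1) *t 1%:M + 1%:M *t diag_mx (map_mx (real_complex R) t2).
    apply/matrixP => i j; case: (mxtens_indexP (i : 'I_(2 * 2))) => i0 i1.
    case: (mxtens_indexP (j : 'I_(2 * 2))) => j0 j1.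
    rewrite [RHS]mxE !tensmxE !mxE !mxtens_indexK mxtens_index_eq4.
    by case: (i0 == j0); case: (i1 == j1);
       rewrite /= ?mulr1n ?mulr0n ?mulr1 ?mulr0 ?mul1r ?mul0r ?addr0 // rmorphD.
  have e3 (D1 D2 : 'M[C]_2) : (P1^t* ) *t (P2^t* ) *m (D1 *t 1%:M + 1%:M *t D2) *m (P1 *t P2) =
      (P1^t* *m D1 *m P1) *t 1%:M + 1%:M *t (P2^t* *m D2 *m P2).
    rewrite mulmxDr mulmxDl !tensmx_mul !mulmx1.
    by rewrite (unitarymx_trCmul hP1) (unitarymx_trCmul hP2).
  by symmetry; exact: e3.
rewrite (evol_spec _ hP) [@udiag]unlock /P [in LHS](tens_trC P1 P2).
have -> : (diag_mx (phases t) : 'M[C]_4) = diag_mx (phases t1) *t diag_mx (phases t2).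
  apply/matrixP => i j; case: (mxtens_indexP (i : 'I_(2 * 2))) => i0 i1.
  case: (mxtens_indexP (j : 'I_(2 * 2))) => j0 j1.
  apply: etrans (esym (tensmxE (diag_mx (phases t1)) (diag_mx (phases t2)) i0 i1 j0 j1)).
  rewrite ![diag_mx _ _ _]mxE !phasesE mxE !mxtens_indexK mxtens_index_eq4 phaseD.
  by case: (i0 == j0); case: (i1 == j1); rewrite /= ?mulr1n ?mulr0n ?mulr0 ?mul0r.
have e4 (D1 D2 : 'M[C]_2) : (P1^t* ) *t (P2^t* ) *m (D1 *t D2) *m (P1 *t P2) =
    (P1^t* *m D1 *m P1) *t (P2^t* *m D2 *m P2) by rewrite !tensmx_mul.
exact: e4.
Qed.

Lemma swapped_tens (A B : 'M[C]_2) : swapped (A *t B) = B *t A.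
Proof.
have h (x y : 'cV[C]_2) : swapped (A *t B) *m (x *t y) = (B *t A) *m (x *t y).
  rewrite /swapped -mulmxA swapgateE -mulmxA.
  rewrite [(A *t B) *m _](tensmx_mul A B y x) swapgateE.
  exact: (esym (tensmx_mul B A x y)).
apply/matrixP => i j; case: (mxtens_indexP (j : 'I_(2 * 2))) => j0 j1.
have /matrixP/(_ i 0) := h (delta_mx j0 0) (delta_mx j1 0).
have -> : (delta_mx j0 0 : 'cV[C]_2) *t (delta_mx j1 0 : 'cV[C]_2) =
    delta_mx (mxtens_index (j0, j1)) 0 :> 'cV[C]_4.
  apply/matrixP => k l; case: (mxtens_indexP (k : 'I_(2 * 2))) => k0 k1.
  rewrite [LHS]mxE !mxE mxtens_indexK !ord1 !eqxx !andbT mxtens_index_eq4.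
  by case: (k0 == j0); case: (k1 == j1); rewrite /= ?mulr1 ?mulr0 ?mul0r.
by rewrite -!colE ![col _ _ _ _]mxE.
Qed.

Lemma swapped_local (H1 H2 : 'M[C]_2) :
  swapped (H1 *t (1%:M : 'M[C]_2) + (1%:M : 'M[C]_2) *t H2) =
  H2 *t (1%:M : 'M[C]_2) + (1%:M : 'M[C]_2) *t H1.
Proof.
have swappedD X Y : swapped (X + Y) = swapped X + swapped Y.
  by rewrite /swapped mulmxDr mulmxDl.
by rewrite swappedD !swapped_tens [LHS]addrC.
Qed.

(** This matrix sends the first product basis vector to a maximally entangled state, which no tensor
    product can do. *)
Lemma entangler_unitary : (mx4 [:: [:: rsqrt2; 0; 0; rsqrt2]; [:: 0; 1; 0; 0];
  [:: 0; 0; 1; 0]; [:: rsqrt2; 0; 0; - rsqrt2]] : 'M[C]_4) \is unitarymx.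
Proof.
apply/unitarymxP; apply/matrixP => i j; rewrite !mxE !big_ord_recl big_ord0 !mxE.
have hs := @rsqrt2_sqr C; have hr := @rsqrt2_real C.
case: i => [[|[|[|[|//]]]] hi] /=; case: j => [[|[|[|[|//]]]] hj] /=;
rewrite /= ?(rmorphN, rmorph0, rmorph1) /= ?hr
  ?(mulr0, mul0r, mulr1, mul1r, addr0, add0r, mulrNN, mulrN, mulNr) ?hs //; by field.
Qed.

(* The first column of a tensor product satisfies [M00 M30 = M10 M20]. *)
Lemma local_not_universal H : H \is hermsymmx ->
  (exists L, local_hamiltonian L /\ T_similar H L) -> ~ two_universal H.
Proof.
move=> hH [L [[H1 [H2 [h1 h2 eL]]] [P [hP PL PT]]]] /two_universalP hu.
have PP := unitarymxP hP; have PP' := unitarymx_trCmul hP.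
have hP' : P^t* \is unitarymx by rewrite trmxC_unitary.
(* As [P] commutes with the swap gate, a single conjugation makes both generators local. *)
have PSL : P *m swapped H *m P^t* = swapped L.
  have PT' : swapgate R *m P^t* = P^t* *m swapgate R.
    by have := congr1 (fun X => X^t*) PT; rewrite !trmx_mul !map_mxM swapgate_trC.
  by rewrite PL /swapped !mulmxA PT -!mulmxA PT' !mulmxA.
have wv W : word H W -> exists A B : 'M[C]_2, P *m W *m P^t* = A *t B.
  apply: (word_ind (S := fun W => exists A B : 'M[C]_2, P *m W *m P^t* = A *t B)).
  - by exists 1%:M, 1%:M; rewrite mulmx1 PP tens1mx.
  - move=> V V' [A [B e]] [A' [B' e']]; exists (A *m A'), (B *m B').
    rewrite -(tensmx_mul A B A' B') -e -e' !mulmxA; congr (_ *m _ *m _).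
    by rewrite -[in RHS](mulmxA _ (P^t*)) PP' mulmx1.
  - have tl (K1 K2 : 'M[C]_2) (t : R) :
        t%:C *: (K1 *t (1%:M : 'M[C]_2) + (1%:M : 'M[C]_2) *t K2) =
        (t%:C *: K1) *t (1%:M : 'M[C]_2) + (1%:M : 'M[C]_2) *t (t%:C *: K2).
      apply/matrixP => i j; rewrite !mxE; ring.
    move=> [] t; rewrite /letter /=.
    + rewrite -(evol_conj (hermZ t hH) hP) -scalemxAr -scalemxAl -PL eL tl.
      by apply: evol_local; exact: hermZ.
    + rewrite -(evol_conj (hermZ t (swapped_herm hH)) hP) -scalemxAr -scalemxAl.
      by rewrite PSL eL swapped_local tl; apply: evol_local; exact: hermZ.
set X : 'M[C]_4 := mx4 [:: [:: rsqrt2; 0; 0; rsqrt2]; [:: 0; 1; 0; 0];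
  [:: 0; 0; 1; 0]; [:: rsqrt2; 0; 0; - rsqrt2]].
have hX : X \is unitarymx := entangler_unitary.
have hU : P^t* *m X *m P \is unitarymx.
  exact: mul_unitarymx (mul_unitarymx hP' hX) hP.
have [W [hW cW]] := approx_seq (fun e e0 => hu _ e hU e0).
have cPW i j : (fun n => (P *m W n *m P^t*) i j : CN) @ \oo --> (X i j : CN).
  have -> : X = P *m (P^t* *m X *m P) *m P^t*.
    by rewrite !mulmxA PP mul1mx -mulmxA PP mulmx1.
  have eE (Y : 'M[C]_4) : (P *m Y *m P^t*) i j = \sum_l (\sum_k P i k * Y k l) * (P^t*) l j.
    by rewrite mxE; apply: eq_bigr => l _; rewrite mxE.
  rewrite eE (_ : (fun n => _) = (fun n => \sum_l (\sum_k P i k * W n k l) * (P^t*) l j)); last first.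
    by apply/funext => n; exact: eE.
  apply: (@cvg_big CN _ +%R 0 xpredT _ _ _ _
      (fun l n => (\sum_k P i k * W n k l) * (P^t*) l j)
      (fun l => (\sum_k P i k * (P^t* *m X *m P) k l) * (P^t*) l j)).
    exact: (@add_continuous CN).
  move=> l _; apply: (@cvgMr_tmp CN).
  apply: (@cvg_big CN _ +%R 0 xpredT _ _ _ _
      (fun k n => P i k * W n k l) (fun k => P i k * (P^t* *m X *m P) k l)).
    exact: (@add_continuous CN).
  by move=> k _; apply: (@cvgMl_tmp CN); exact: cW.
pose Z n := P *m W n *m P^t*.
have q1 : (fun n => Z n 0 0 * Z n 3 0 : CN) @ \oo --> (X 0 0 * X 3 0 : CN).
  by apply: (@cvgM CN); exact: cPW.
have q2 : (fun n => Z n 1 0 * Z n 2 0 : CN) @ \oo --> (X 1 0 * X 2 0 : CN).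
  by apply: (@cvgM CN); exact: cPW.
have e : (fun n => Z n 0 0 * Z n 3 0) = (fun n => Z n 1 0 * Z n 2 0).
  apply/funext => n; have [A [B eAB]] := wv _ (hW n); rewrite /Z eAB.
  rewrite !mxE.
  have u0 : @mxtens_unindex 2 2 (0 : 'I_4) = (0, 0) by congr (_, _); exact: val_inj.
  have u1 : @mxtens_unindex 2 2 (1 : 'I_4) = (0, 1) by congr (_, _); exact: val_inj.
  have u2 : @mxtens_unindex 2 2 (2 : 'I_4) = (1, 0) by congr (_, _); exact: val_inj.
  have u3 : @mxtens_unindex 2 2 (3 : 'I_4) = (1, 1) by congr (_, _); exact: val_inj.
  rewrite u0 u1 u2 u3 /=; ring.
rewrite e in q1.
have : X 0 0 * X 3 0 = X 1 0 * X 2 0.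
  by apply: (cvg_unique (@norm_hausdorff _ CN) q1); exact: q2.
(* For the entangling matrix the left side is [1 / 2] and the right side is zero. *)
rewrite /X !mxE /= mulr0 rsqrt2_sqr => /eqP.
by rewrite invr_eq0 pnatr_eq0.
Qed.

End Obstructions.

(** * Universality without obstructions *)

(** An element has only one negative, so three distinct elements cannot all be matched with each
    other: one is zero and the other two are opposite. *)
Lemma opposite_pair (V : zmodType) (x y z : V) : x != y -> y != z -> x != z ->
  [\/ x = 0, x + y = 0 | x + z = 0] -> [\/ y = 0, y + x = 0 | y + z = 0] ->
  [\/ z = 0, z + x = 0 | z + y = 0] ->
  [\/ x = 0 /\ y + z = 0, y = 0 /\ x + z = 0 | z = 0 /\ x + y = 0].
Proof.
have eq_of (p q r : V) : p + q = 0 -> p + r = 0 -> q = r.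
  by move=> h1 h2; apply: (addrI p); rewrite h1 h2.
move=> /eqP xy /eqP yz /eqP xz [hx|hx|hx] hy hz.
- case: hy => [hy|hy|hy]; last by constructor 1.
    by case: xy; rewrite hx hy.
  by case: xy; move: hy; rewrite hx addr0.
- case: hz => [hz|hz|hz]; first by constructor 3.
    by case: yz; apply: (eq_of x) => //; rewrite addrC.
  by case: xz; apply: (eq_of y); rewrite addrC.
- case: hy => [hy|hy|hy]; first by constructor 2.
    by case: yz; apply: (eq_of x) => //; rewrite addrC.
  by case: xy; apply: (eq_of z); rewrite addrC.
Qed.

Section Universality.
Context {R : realType}.
Local Notation C := R[i].
Implicit Types (H U W K : 'M[C]_4).
Import Normc.

Definition word_closure H U := U \is unitarymx /\
  forall e : R, 0 < e -> exists2 W, word H W & sumnorm (U - W) < e.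

Lemma word_unitary H W : H \is hermsymmx -> word H W -> W \is unitarymx.
Proof.
move=> hH; apply: (word_ind (S := fun W => W \is unitarymx)).
- exact: unitary1.
- by move=> V V' hV hV'; exact: mul_unitarymx hV hV'.
- by move=> [] t; apply: evol_unitary; apply: hermZ; last exact: swapped_herm.
Qed.

Lemma word_closure_word H W : H \is hermsymmx -> word H W -> word_closure H W.
Proof.
move=> hH hW; split; first exact: word_unitary hW.
by move=> e e0; exists W => //; rewrite subrr sumnorm0.
Qed.

Lemma word_closure_semigroup H : H \is hermsymmx -> closed_semigroup (word_closure H).
Proof.
move=> hH; split.
- exact: word_closure_word hH (word1 H).
- move=> U V [hU aU] [hV aV]; split; first exact: mul_unitarymx hU hV.
  move=> e e0; have e1 : 0 < e / 2 / 16 by rewrite !divr_gt0.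
  have [W hW dW] := aU _ e1; have [W' hW' dW'] := aV _ e1.
  exists (W *m W'); first exact: wordM hW hW'.
  have -> : U *m V - W *m W' = (U - W) *m V + W *m (V - W').
    by rewrite mulmxBl mulmxBr addrA subrK.
  have b1 := sumnormM_unitaryr (U - W) hV.
  have b2 := sumnormM_unitaryl (V - W') (word_unitary hH hW).
  apply: le_lt_trans (sumnormD _ _) _; apply: le_lt_trans (lerD b1 b2) _.
  move: (sumnorm (U - W)) (sumnorm (V - W')) dW dW' => x y hx hy.
  rewrite natrM; lra.
- by move=> U [].
- move=> U hU h; split => // e e0; have e2 : 0 < e / 2 by rewrite divr_gt0.
  have [V [_ aV] dV] := h _ e2; have [W hW dW] := aV _ e2.
  exists W => //; have -> : U - W = (U - V) + (V - W) by rewrite addrA subrK.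
  apply: le_lt_trans (sumnormD _ _) _.
  by rewrite (_ : e = e / 2 + e / 2); [exact: ltrD | field].
Qed.

(** Positive times make [K] tangent; the inverse evolutions, in the closure by recurrence, make
    [- K] tangent. *)
Lemma lie_generator H K : H \is hermsymmx -> K = H \/ K = swapped H ->
  lie (word_closure H) K.
Proof.
move=> hH hK; have hG := word_closure_semigroup hH.
have hKh : K \is hermsymmx by case: hK => ->; [|exact: swapped_herm].
have GK (h : R) : 0 < h -> word_closure H (evol (h%:C *: K)).
  move=> h0; apply: (word_closure_word hH).
  by case: hK => ->; [exact: (@word_letter _ H true)|exact: (@word_letter _ H false)].
split; first exact: evol_tangent.
apply: evol_tangent; first exact: hermN.
move=> h h0; rewrite scalerN -(evol_trC (hermZ h hKh)).
by apply: closed_semigroup_trC => //; exact: GK.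
Qed.

Lemma real_lie_conj (G : 'M[C]_4 -> Prop) (Q : 'M[C]_4) : closed_semigroup G ->
  Q \is unitarymx ->
  @real_lie (R[i] : numClosedFieldType) 3 (fun K => lie G (Q *m (K : 'M[C]_4) *m Q^t*)).
Proof.
move=> hG hQ; split.
- by move=> A B hA hB; rewrite mulmxDr mulmxDl; exact: lieD.
- move=> a A /complex_realP[x ->] hA.
  by rewrite -scalemxAr -scalemxAl; exact: lieZ.
- move=> A B hA hB; have := lie_bracket hG hA hB; congr (lie G _).
  have QQ : Q^t* *m Q = 1%:M := unitarymx_trCmul hQ.
  have e (X Y : 'M[C]_4) : (Q *m X *m Q^t*) *m (Q *m Y *m Q^t*) = Q *m (X *m Y) *m Q^t*.
    by rewrite !mulmxA -(mulmxA _ (Q^t*) Q) QQ mulmx1.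
  rewrite !e -mulmxBl -mulmxBr scalemxAl scalemxAr complexiE.
  by [].
Qed.

(** The exceptional spectrum [l], [0], [-l]: distinct moduli at the opposite values allow
    [arrow_full_pair], while equal ones would make [H] local up to T-similarity by
    [local_of_pair]. *)
Lemma arrow_full_of_pair (H Q : 'M[C]_4) (a : 'I_3 -> C) (b : 'cV[C]_3) (c : C)
    (g : 'M[C]_(3 + 1) -> Prop) (j0 j1 j2 : 'I_3) :
  H \is hermsymmx -> Q \is unitarymx ->
  swapgate R *m Q = Q *m (parity : 'M[C]_4) ->
  H *m Q = Q *m (arrow_form a b c : 'M[C]_4) ->
  (forall k, a k \is Num.real) -> c \is Num.real ->
  injective a -> (forall k, b k 0 != 0) ->
  ~ (exists L, local_hamiltonian L /\ T_similar H L) ->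
  real_lie g -> g (block_mx (diag_mx (\row_k a k)) 0 0 c%:M) -> g (arrow b) ->
  j0 != j1 -> j0 != j2 -> j1 != j2 -> a j0 - c = 0 -> (a j1 - c) + (a j2 - c) = 0 ->
  forall v, g (arrow v).
Proof.
move=> hH hQ TQ HQ ar cr ainj b0 nloc lg gD gb n01 n02 n12 d0 d12 v.
have d2 : a j2 - c = - (a j1 - c) by apply/eqP; rewrite -addr_eq0 addrC d12.
have d1 : a j1 - c != 0.
  apply: contraNneq n01 => e; apply/eqP/ainj.
  by apply: (addIr (- c)); rewrite e d0.
have cover (k : 'I_3) : [|| k == j0, k == j1 | k == j2].
  move: n01 n02 n12; rewrite -!val_eqE /=.
  by case: j0 j1 j2 k {d0 d12 d2 d1} => [[|[|[|//]]] ?] [[|[|[|//]]] ?] [[|[|[|//]]] ?] [[|[|[|//]]] ?].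
have [bb|nb] := eqVneq `|b j1 0| `|b j2 0|; last first.
  exact: (arrow_full_pair lg ar cr gD gb v ainj b0 cover n01 n02 n12 d0 d2 d1 nb).
case: nloc.
pose f (k : 'I_3) := nth j0 [:: j1; j0; j2] k.
have finj : injective f.
  move=> x y; rewrite /f => e; apply: val_inj; apply/eqP.
  rewrite -(nth_uniq j0 _ _ (_ : uniq [:: j1; j0; j2])) ?e ?ltn_ord //.
  by rewrite /= !inE negb_or n12 eq_sym n01 n02.
have e1 : a (f 0) = c + (a j1 - c) by rewrite /f /= addrC subrK.
have e0 : a (f 1) = c by rewrite /f /=; apply/eqP; rewrite -subr_eq0 d0.
have e2 : a (f 2) = c - (a j1 - c) by rewrite /f /= -d2 addrC subrK.
have lr : a j1 - c \is Num.real by rewrite rpredB.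
have [P [H1 [H2 [hP PT h1 h2 hL]]]] := local_of_pair hQ TQ HQ finj ar cr lr b0 e1 e0 e2 bb.
exists (P *m H *m P^t*); split; first by exists H1, H2.
by exists P.
Qed.

Lemma universal_of_obstruction_free H : H \is hermsymmx ->
  ~ [\/ exists L : 'M[C]_4, local_hamiltonian L /\ T_similar H L,
        share_eigenvector H (swapgate R) | \tr H = 0] -> two_universal H.
Proof.
move=> hH hn.
have nloc : ~ (exists L, local_hamiltonian L /\ T_similar H L).
  by move=> h; apply: hn; constructor 1.
have nsh : ~ (exists x : 'cV[C]_4, exists l, [/\ x != 0, H *m x = l *: x & swapgate R *m x = x]).
  move=> [x [l [x0 hx tx]]]; apply: hn; constructor 2; exists x.
  by split; split=> //; [exists l | exists 1; rewrite scale1r].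
have tr0 : \tr H != 0 by apply/eqP => h; apply: hn; constructor 3.
have [Q [a [b [c [hQ TQ HQ ar cr]]]]] := normal_form hH.
have b0 k : b k 0 != 0.
  by apply/eqP => bk; apply: nsh; exact: (shared_of_zero hQ TQ HQ bk).
have ainj : injective a.
  move=> i j e; apply/eqP/negPn/negP => ij; apply: nsh.
  exact: (shared_of_eq hQ TQ HQ ij e).
have hG := word_closure_semigroup hH; set G := word_closure H in hG.
have QQ := unitarymxP hQ; have QQ' := unitarymx_trCmul hQ.
pose g (K : 'M[C]_(3 + 1)) := lie G (Q *m (K : 'M[C]_4) *m Q^t*).
have lg : real_lie g := real_lie_conj hG hQ.
have eH : H = Q *m (arrow_form a b c : 'M[C]_4) *m Q^t*.
  by rewrite -HQ -mulmxA QQ mulmx1.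
(* Swapping the qubits only changes the sign of the coupling [b], so half the sum and half the
   difference of the two generators are the diagonal part and [arrow b]. *)
have eS : swapped H = Q *m (arrow_form a (- b) c : 'M[C]_4) *m Q^t*.
  have QT : Q^t* *m swapgate R = (parity : 'M[C]_4) *m Q^t*.
    by rewrite -[LHS]mulmx1 -QQ mulmxA -(mulmxA (Q^t*)) TQ !mulmxA QQ' mul1mx.
  have e : parity *m arrow_form a b c *m parity = arrow_form a (- b) c.
    rewrite /parity /arrow_form !mulmx_block !mulmx0 !mul0mx !addr0 !add0r.
    by rewrite !mul1mx !mulmx1 !mulmxN !mulmx1 !mulNmx !mul1mx opprK trC_opp.
  rewrite /swapped {1}eH !mulmxA TQ -!mulmxA QT !mulmxA; congr (_ *m _).
  by rewrite -!mulmxA; congr (_ *m _); rewrite mulmxA; exact: e.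
have gN : g (arrow_form a b c) by rewrite /g -eH; apply: lie_generator => //; left.
have gS : g (arrow_form a (- b) c) by rewrite /g -eS; apply: lie_generator => //; right.
case: (lg) => gD gZ _.
have half : (2^-1 : C) \is Num.real by rewrite rpredV rpredMn ?rpred1.
have half_dbl p q (X : 'M[C]_(p, q)) : 2^-1 *: (X + X) = X.
  by apply/matrixP => i j; rewrite !mxE; field.
have gX : g (block_mx (diag_mx (\row_k a k)) 0 0 c%:M).
  have := gZ _ _ half (gD _ _ gN gS); congr (g _).
  rewrite /arrow_form add_block_mx scale_block_mx trC_opp !subrr !scaler0.
  by rewrite !half_dbl.
have gb : g (arrow b).
  have := gZ _ _ half (gD _ _ gN (gZ _ _ (rpredN1 _) gS)); congr (g _).
  rewrite /arrow_form /arrow scale_block_mx add_block_mx scale_block_mx trC_opp.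
  rewrite !scaleN1r !opprK !subrr !scaler0.
  by rewrite !half_dbl.
have Vall v : g (arrow v).
  pose d k := a k - c.
  (* Either some nonzero [d j] has no opposite among the others, or each [d j] is zero or has one;
     [opposite_pair] then leaves the values [0], [l], [-l]. *)
  have [|nj] := pselect (exists j, d j != 0 /\ forall k, k != j -> d j + d k != 0).
    by move=> [j [dj hj]]; exact: (arrow_full_isolated lg ar cr gX gb v ainj b0 dj hj).
  have dinj i j : i != j -> d i != d j.
    by apply: contra => /eqP /addIr /ainj ->.
  have alt (i j k : 'I_3) : i != j -> i != k -> j != k -> [\/ d i = 0, d i + d j = 0 | d i + d k = 0].
    move=> ij ik jk.
    have [|e1] := eqVneq (d i) 0; first by constructor 1.
    have [|e2] := eqVneq (d i + d j) 0; first by constructor 2.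
    have [|e3] := eqVneq (d i + d k) 0; first by constructor 3.
    case: nj; exists i; split => // l li.
    have : [|| l == i, l == j | l == k].
      move: ij ik jk; rewrite -!val_eqE /=.
      by case: i j k l {e1 e2 e3 li} => [[|[|[|//]]] ?] [[|[|[|//]]] ?] [[|[|[|//]]] ?] [[|[|[|//]]] ?].
    by rewrite (negbTE li) /= => /orP[] /eqP ->.
  have key := arrow_full_of_pair hH hQ TQ HQ ar cr ainj b0 nloc lg gX gb.
  have [] := @opposite_pair _ (d 0) (d 1) (d 2).
  - exact: dinj. - exact: dinj. - exact: dinj.
  - exact: (alt 0 1 2). - exact: (alt 1 0 2). - exact: (alt 2 0 1).
  - by move=> [h0 h1]; exact: (key 0 1 2).
  - by move=> [h0 h1]; exact: (key 1 0 2).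
  - by move=> [h0 h1]; exact: (key 2 0 1).
have trE : \tr (diag_mx (\row_k a k)) + c = \tr H.
  have e : \tr (arrow_form a b c) = \tr (diag_mx (\row_k a k)) + c.
    by rewrite /arrow_form mxtrace_block mxtrace_scalar mulr1n.
  by rewrite eH mxtrace_mulC mulmxA QQ' mul1mx; symmetry; exact: e.
have ah : diag_mx (\row_k a k) \is hermsymmx.
  apply/hermitian_trC; rewrite tr_diag_mx map_diag_mx; congr diag_mx.
  by apply/rowP => k; rewrite !mxE; exact: realCi.
have trr : \tr (diag_mx (\row_k a k)) + c \is Num.real.
  by rewrite rpredD // mxtrace_diag rpred_sum // => k _; rewrite mxE.
apply/two_universalP => U e hU e0.
(* The exponential is onto the unitary group, so it suffices that the Lie algebra contains every
   Hermitian [K]. *)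
have [K hK eU] := unitary_evol hU.
have gK : g (Q^t* *m K *m Q).
  apply: (real_lie_full lg Vall gX trr); rewrite ?trE //.
  have := herm_conj (Q^t*) hK; rewrite trmxCK.
  exact.
have lK : lie G K.
  by move: gK; rewrite /g !mulmxA QQ mul1mx -mulmxA QQ mulmx1.
have [_ aU] := tangent_evol hG lK.1.
have [W hW dW] := aU e e0; exists W => //.
by rewrite eU; apply: le_lt_trans (opnorm_le_sumnorm _) dW.
Qed.

End Universality.

Theorem theorem2 (R : realType) (H : 'M[R[i]]_4) (hH : H \is hermsymmx) :
  two_universal H <->
  ~ [\/ exists L : 'M[R[i]]_4, local_hamiltonian L /\ T_similar H L,
        share_eigenvector H (swapgate R) |
        \tr H = 0].
Proof.
split; last exact: universal_of_obstruction_free.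
move=> hu [hL|hs|h0].
- exact: local_not_universal hH hL hu.
- exact: shared_not_universal hH hs hu.
- exact: traceless_not_universal hH h0 hu.
Qed.
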